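(* Let $[\boldsymbol D,\boldsymbol o]$ be a unimodular discrete space. For any two equivariant weight functions $\boldsymbol w_1$ and $\boldsymbol w_2$ such that $\mathbb P[\exists v\in\boldsymbol D:\boldsymbol w_2(v)\ne0]=1$ and $\mathbb E[\boldsymbol w_1(\boldsymbol o)]<\infty$, one has $$\underline{\mathrm{growth}}(\boldsymbol w_1(N_r(\boldsymbol o)))\le\overline{\mathrm{growth}}(\boldsymbol w_2(N_r(\boldsymbol o)))\quad\text{a.s.}$$ In particular, if $\boldsymbol w_1(N_r(\boldsymbol o))$ and $\boldsymbol w_2(N_r(\boldsymbol o))$ have well defined growth rates, then their growth rates are equal.
   Context: Growth rates. For a nonnegative function $f$, $\overline{\mathrm{growth}}(f):=\limsup_{r\to\infty}\frac{\log f(r)}{\log r}$ and $\underline{\mathrm{growth}}(f):=\liminf_{r\to\infty}\frac{\log f(r)}{\log r}$; the growth rate is well defined if the limit exists. Discrete spaces. A discrete space is a metric space $(D,d)$ in which every ball of finite radius is finite; $N_r(v)$ is the closed ball. A pointed discrete space $(D,o)$ has a distinguished point $o$ (the origin); doubly-pointed ones have two. A marked discrete space carries a function $m:D\times D\to\Xi$ with $\Xi$ a complete separable metric space; $m(x):=m(x,x)$. Isomorphisms are isometries preserving origins and marks. $\mathcal D_*,\mathcal D_{**}$ (resp. $\mathcal D'_*,\mathcal D'_{**}$) are the sets of isomorphism classes of pointed and doubly-pointed discrete spaces (resp. marked ones), with classes in brackets, and the Borel $\sigma$-field of the following metric: $1\wedge$ the infimum of $\epsilon>0$ such that, in both directions,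 there is an injection from the closed ball of radius $1/\epsilon$ around the origin of one space into the other, preserving origins and changing distances and marks by at most $\epsilon$. A unimodular discrete space is a random element $[\boldsymbol D,\boldsymbol o]$ of $\mathcal D_*$ such that $\mathbb E[\sum_{v\in\boldsymbol D}g[\boldsymbol D,\boldsymbol o,v]]=\mathbb E[\sum_{v\in\boldsymbol D}g[\boldsymbol D,v,\boldsymbol o]]$ for all measurable $g:\mathcal D_{**}\to[0,\infty)$. Equivariant weight functions. An equivariant process with values in $\Xi$ assigns to every deterministic discrete space $D$ a random element $\boldsymbol Z_D$ of $\Xi^{D\times D}$ (extra randomness allowed) such that (i) for every isometry $\rho:D_1\to D_2$, $\boldsymbol Z_{D_1}\circ\rho^{-1}$ has the same distribution as $\boldsymbol Z_{D_2}$; (ii) for every measurable $A\subseteq\mathcal D'_*$, $[D,o]\mapsto\mathbb P[[D,o;\boldsymbol Z_D]\in A]$ is measurable. It suffices that it be defined for almost all realizations of $\boldsymbol D$; $[\boldsymbol D,\boldsymbol o;\boldsymbol Z_{\boldsymbol D}]$ is obtained by sampling $[\boldsymbol D,\boldsymbol o]$ and then the marking. An equivariant weight function $\boldsymbol w$ is an equivariant process with values in $[0,\infty)$ (marks on points); $\boldsymbol w(S):=\sum_{v\in S}\boldsymbol w(v)$ for $S\subseteq\boldsymbol D$.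
   Formalization: The ''in particular'' claim is proved under the added assumptions that w_1 is a.s. not identically zero and E[w_2(o)] < ∞, since without them it fails (e.g. on Z with w_1 = 0, w_2 = 1, or w_2 i.i.d. heavy-tailed with infinite mean). *)

(* Defs.v *)
From HB Require Import structures.
From mathcomp Require Import all_boot all_order all_algebra.
From mathcomp Require Import all_classical all_reals all_analysis.
From mathcomp Require Import measurable_realfun.

Set Implicit Arguments.
Unset Strict Implicit.
Unset Printing Implicit Defensive.

Import Order.TTheory GRing.Theory Num.Theory.
Import numFieldNormedType.Exports.

Local Open Scope classical_set_scope.
Local Open Scope ring_scope.
Local Open Scope quotient_scope.

(* Mark spaces. A base point is required only because the measurable types of
   the library are pointed. *)
#[short(type="pmetricType")]
HB.structure Definition PointedMetric (K : numDomainType) :=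
  { M of Metric K M & isPointed M }.

Definition nnreal (R : realType) := {nonneg R}.

Section nnreal_metric.
Context {R : realType}.
Implicit Types x y z : nnreal R.

HB.instance Definition _ := Choice.copy (nnreal R) {nonneg R}.

Definition nnval (x : nnreal R) : R := Itv.r x.

Definition nnreal_dist x y : R := `|nnval x - nnval y|.

Let nnreal_distxx x : nnreal_dist x x = 0.
Proof. by rewrite /nnreal_dist subrr normr0. Qed.

Let nnreal_dist_positivity x y : nnreal_dist x y = 0 -> x = y.
Proof. by move=> /normr0_eq0 /subr0_eq xy; apply/val_inj. Qed.

Let nnreal_dist_sym x y : nnreal_dist x y = nnreal_dist y x.
Proof. exact: distrC. Qed.

Let nnreal_dist_triangle y x z :
  nnreal_dist x z <= nnreal_dist x y + nnreal_dist y z.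
Proof. exact: ler_distD. Qed.

HB.instance Definition _ := @isMetric.Build R (nnreal R) nnreal_dist
  nnreal_distxx nnreal_dist_positivity nnreal_dist_sym nnreal_dist_triangle.
HB.instance Definition _ := isPointed.Build (nnreal R) 0%:nng.

End nnreal_metric.

(* The one-point space: spaces with trivial marks are unmarked spaces. *)
Definition trivial_mark (R : realType) := unit.

Section trivial_mark_metric.
Context {R : realType}.

HB.instance Definition _ := Choice.copy (trivial_mark R) unit.

Definition trivial_dist (x y : trivial_mark R) : R := 0.

Let trivial_dist_positivity x y : trivial_dist x y = 0 -> x = y.
Proof. by case: x; case: y. Qed.

Let trivial_dist_triangle y x z :
  trivial_dist x z <= trivial_dist x y + trivial_dist y z.
Proof. by rewrite /trivial_dist addr0. Qed.

HB.instance Definition _ := @isMetric.Build R (trivial_mark R) trivial_dist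
  (fun=> erefl) trivial_dist_positivity (fun _ _ => erefl) trivial_dist_triangle.
HB.instance Definition _ := isPointed.Build (trivial_mark R) tt.

End trivial_mark_metric.

Section spaces.
Variable R : realType.

(* The carrier is a bare type with a distance, not a [metricType]: the universe
   of all metric types is too large to support the choice structure that
   quotients require.  The [metricType] structure is recovered below. *)
Record discreteSpace := DiscreteSpace {
  carrier :> Type ;
  dist : carrier -> carrier -> R ;
  distxx : forall x, dist x x = 0 ;
  dist_positivity : forall x y, dist x y = 0 -> x = y ;
  dist_sym : forall x y, dist x y = dist y x ;
  dist_triangle : forall y x z, dist x z <= dist x y + dist y z ;
  finite_dist_ball : forall x r, finite_set [set y | dist x y <= r]
}.

HB.instance Definition _ (D : discreteSpace) := gen_eqMixin (carrier D).
HB.instance Definition _ (D : discreteSpace) := gen_choiceMixin (carrier D).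
HB.instance Definition _ (D : discreteSpace) := @isMetric.Build R (carrier D)
  (@dist D) (@distxx D) (@dist_positivity D) (@dist_sym D) (@dist_triangle D).

Definition cball (D : discreteSpace) (x : D) (r : R) : set D :=
  [set y | mdist x y <= r].

(* [cancel] in both directions makes [rho] bijective with inverse [rhoV]. *)
Definition isometry (D1 D2 : discreteSpace) (rho : D1 -> D2) (rhoV : D2 -> D1) :=
  [/\ cancel rho rhoV, cancel rhoV rho &
      forall x y, mdist (rho x) (rho y) = mdist x y].

(* Marked discrete spaces with k + 1 distinguished points, the first one being
   the origin around which balls are taken: k = 0 for pointed spaces and
   k = 1 for doubly-pointed ones. *)
Record mspace (Xi : pmetricType R) (k : nat) := MSpace {
  space :> discreteSpace ;
  mark : space -> space -> Xi ;
  origins : k.+1.-tuple space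
}.

Definition origin Xi k (X : mspace Xi k) : X := thead (origins X).

HB.instance Definition _ (Xi : pmetricType R) (k : nat) := gen_eqMixin (mspace Xi k).
HB.instance Definition _ (Xi : pmetricType R) (k : nat) := gen_choiceMixin (mspace Xi k).

Section classes.
Variables (Xi : pmetricType R) (k : nat).
Implicit Types X Y Z : mspace Xi k.

Definition isomorphic X Y := exists rho rhoV,
  [/\ @isometry X Y rho rhoV,
      (forall x y, mark (rho x) (rho y) = mark x y) &
      map rho (origins X) = origins Y :> seq Y].

Lemma isomorphic_refl X : isomorphic X X.
Proof. by exists id, id; split=> //; rewrite map_id. Qed.

Lemma isomorphic_sym X Y : isomorphic X Y -> isomorphic Y X.
Proof.
move=> [f [g [[fK gK df] mf fo]]]; exists g, f; split.
- by split=> // x y; rewrite -df !gK.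
- by move=> x y; rewrite -mf !gK.
- by rewrite -fo mapK.
Qed.

Lemma isomorphic_trans X Y Z : isomorphic X Y -> isomorphic Y Z -> isomorphic X Z.
Proof.
move=> [f [g [[fK gK df] mf fo]]] [f' [g' [[f'K g'K df'] mf' f'o]]].
exists (f' \o f), (g \o g'); split.
- by split; [exact: can_comp|exact: can_comp|move=> x y /=; rewrite df' df].
- by move=> x y /=; rewrite mf' mf.
- by rewrite map_comp fo f'o.
Qed.

Definition isomorphicb X Y := `[< isomorphic X Y >].

Let isomorphicb_refl : reflexive isomorphicb.
Proof. by move=> X; apply/asboolP; exact: isomorphic_refl. Qed.

Let isomorphicb_sym : symmetric isomorphicb.
Proof. by move=> X Y; apply/asboolP/asboolP; exact: isomorphic_sym. Qed.

Let isomorphicb_trans : transitive isomorphicb.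
Proof.
by move=> Y X Z /asboolP XY /asboolP YZ; apply/asboolP; exact: isomorphic_trans YZ.
Qed.

Canonical isomorphic_equiv :=
  EquivRel isomorphicb isomorphicb_refl isomorphicb_sym isomorphicb_trans.

Definition iso_class := {eq_quot isomorphic_equiv}.

HB.instance Definition _ := Choice.on iso_class.
HB.instance Definition _ := EqQuotient.on iso_class.

Definition class_of X : iso_class := \pi_iso_class X.
Definition rep (c : iso_class) : mspace Xi k := repr c.

(* [f] is total, so its values outside the ball are free: for k <= 1,
   [map f (origins X) = origins Y] is a constraint only at the distinguished
   points lying in the ball. *)
Definition almost_embeds (e : R) X Y := exists f : X -> Y,
  let B := cball (origin X) e^-1 in
  [/\ set_inj B f,
      map f (origins X) = origins Y :> seq Y,
      forall x y, B x -> B y -> `|mdist (f x) (f y) - mdist x y| <= e &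
      forall x y, B x -> B y -> mdist (mark (f x) (f y)) (mark x y) <= e].

(* [ereal_inf set0 = +oo], so spaces with no admissible e are at distance 1. *)
Definition space_dist X Y : \bar R :=
  mine 1%:E (ereal_inf [set e%:E | e in [set e | [/\ 0 < e, almost_embeds e X Y & almost_embeds e Y X]]]).

Definition class_dist (c c' : iso_class) : \bar R := space_dist (rep c) (rep c').

Definition class_open : set (set iso_class) :=
  [set U | forall c, U c ->
    exists2 e : R, 0 < e & forall c', (class_dist c c' < e%:E)%E -> U c'].

End classes.

Section point.

Let finite_unit (x : unit) (r : R) : finite_set [set y : unit | 0 <= r].
Proof. by apply: (@sub_finite_set _ _ [set tt]) => // -[]. Qed.

Let unit_eq (x y : unit) : (0 : R) = 0 -> x = y.
Proof. by case: x; case: y. Qed.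

Let le00 (x y z : unit) : (0 : R) <= 0 + 0.
Proof. by rewrite addr0. Qed.

Definition singleton_space : discreteSpace :=
  @DiscreteSpace unit (fun _ _ => 0) (fun=> erefl) unit_eq (fun _ _ => erefl)
    le00 finite_unit.

Definition singleton_mspace (Xi : pmetricType R) k : mspace Xi k :=
  @MSpace Xi k singleton_space (fun _ _ => point) (nseq_tuple k.+1 tt).

End point.

HB.instance Definition _ (Xi : pmetricType R) (k : nat) :=
  isPointed.Build (iso_class Xi k) (class_of (singleton_mspace Xi k)).

(* D_*, D_** and D'_* with their Borel sigma-fields. *)
Definition pointed_class := g_sigma_algebraType (@class_open (trivial_mark R) 0).
Definition dpointed_class := g_sigma_algebraType (@class_open (trivial_mark R) 1).
Definition mpointed_class (Xi : pmetricType R) :=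
  g_sigma_algebraType (@class_open Xi 0).

HB.instance Definition _ := Measurable.on pointed_class.
HB.instance Definition _ := Measurable.on dpointed_class.
HB.instance Definition _ (Xi : pmetricType R) := Measurable.on (mpointed_class Xi).

Definition pspace := mspace (trivial_mark R) 0.

Definition pclass (D : discreteSpace) (o : D) : pointed_class :=
  class_of (@MSpace (trivial_mark R) 0 D (fun _ _ => tt) [tuple o]).
Definition dpclass (D : discreteSpace) (o v : D) : dpointed_class :=
  class_of (@MSpace (trivial_mark R) 1 D (fun _ _ => tt) [tuple o; v]).
Definition mpclass (Xi : pmetricType R) (D : discreteSpace) (o : D)
    (m : D -> D -> Xi) : mpointed_class Xi :=
  class_of (@MSpace Xi 0 D m [tuple o]).

Definition prep (c : pointed_class) : pspace := rep c.

(* The law [mu] of a random element of D_* is that of a unimodular space. *)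
Definition unimodular (mu : probability pointed_class R) :=
  forall g : dpointed_class -> R, measurable_fun setT g -> (forall c, 0 <= g c) ->
  (\int[mu]_c (\esum_(v in [set: prep c]) (g (dpclass (origin (prep c)) v))%:E) =
   \int[mu]_c (\esum_(v in [set: prep c]) (g (dpclass v (origin (prep c))))%:E))%E.

(* The product sigma-field on Xi^(D x D). *)
Definition marking_measurable (Xi : pmetricType R) (D : discreteSpace) :
    set (set (D -> D -> Xi)) :=
  <<s [set E | exists x y (B : set Xi),
        <<s (@open Xi) >> B /\ E = [set m | B (m x y)]] >>.

End spaces.

Section processes.
Context {R : realType} {d : measure_display}.
(* [(Om D, P D)] carries the extra randomness used on the deterministic space D;
   several processes may share it, with any dependence between them given D. *)
Variables (Om : discreteSpace R -> measurableType d).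
Variable P : forall D, probability (Om D) R.
Variable mu : probability (pointed_class R) R.

Definition process (Xi : pmetricType R) :=
  forall D : discreteSpace R, Om D -> D -> D -> Xi.

(* [S] is the set of realizations for which the process is defined; it does not
   depend on the origin, and the values of [Z] elsewhere are irrelevant. *)
Definition equivariant_process (Xi : pmetricType R) (Z : process Xi) :=
  exists S : set (pointed_class R),
  [/\ measurable S /\ mu S = 1%E,
      forall (D : discreteSpace R) (o o' : D), S (pclass o) -> S (pclass o'),
      forall (D : discreteSpace R) (o : D), S (pclass o) ->
        forall E, @marking_measurable R Xi D E -> measurable (@Z D @^-1` E),
      forall (D1 D2 : discreteSpace R) (rho : D1 -> D2) (rhoV : D2 -> D1) (o : D1),
        S (pclass o) -> isometry rho rhoV ->
        forall E, @marking_measurable R Xi D2 E ->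
        P D1 [set w | E (fun x y => Z D1 w (rhoV x) (rhoV y))] =
        P D2 [set w | E (Z D2 w)] &
      forall A : set (mpointed_class Xi), measurable A ->
        measurable_fun S (fun c => P (prep c)
          [set w | A (mpclass (origin (prep c)) (Z (prep c) w))])].

(* Weights are the marks of points, m(v) = m(v, v). *)
Definition weight_process := process (nnreal R).

Definition weight (w : weight_process) (D : discreteSpace R) (om : Om D) (v : D) : R :=
  nnval (w D om v v).

Definition weight_set (w : weight_process) (D : discreteSpace R) (om : Om D)
  (A : set D) : R := \sum_(v \in A) weight w om v.

(* An event concerning [D, o] and the markings has probability one: for almost
   every class, and whichever space D represents it, for almost every om. *)
Definition almost_surely (E : forall D : discreteSpace R, D -> set (Om D)) :=
  {ae mu, forall c, forall (D : discreteSpace R) (o : D), pclass o = c ->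
    {ae P D, forall om, E D o om}}.

Definition mean_weight (w : weight_process) : \bar R :=
  (\int[mu]_c (\int[P (prep c)]_om (weight w om (origin (prep c)))%:E))%E.

End processes.

Section growth.
Context {R : realType}.

(* [lne] is the extended logarithm: [lne 0 = -oo], whereas [ln 0 = 0]. *)
Definition log_ratio (f : R -> R) (r : R) : \bar R :=
  (lne (f r)%:E * ((ln r)^-1)%:E)%E.

Definition growth_sup (f : R -> R) : \bar R := limf_esup (log_ratio f) (pinfty_nbhs R).
Definition growth_inf (f : R -> R) : \bar R := limf_einf (log_ratio f) (pinfty_nbhs R).

Definition has_growth (f : R -> R) := cvg (log_ratio f r @[r --> +oo]).
Definition growth (f : R -> R) : \bar R := lim (log_ratio f r @[r --> +oo]).

End growth.

(* Main.v *)
(** The growth rates are compared through one mass transport.  Fix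
    [a < b] and [k], and for [n >= k] put [T1 = n^b] and [T2 = (3n)^a].  Each
    point [o] sends to each [v] in the ball [N_n(o)] the mass [A(o) * B(v)],
    where
      [A(o) = E[w2(N_k(o)); w2(N_3n(o)) <= T2] / #N_2k(o)] and
      [B(v) = E[min(w1(v), T1)]].
    The mass leaving [o] is at least [A(o) * T1 * P[w1(N_n(o)) >= T1]], because
    a sum reaches [T1] as soon as the sum of its terms truncated at [T1] does.
    The mass entering [o] is at most [T2 * B(o)], because every [w2(x)] is
    counted by at most [#N_k(x) <= #N_2k(v)] points [v].  By unimodularity
    [T1 * E[A(o) P[w1(N_n(o)) >= T1]] <= T2 * E[w1(o)]], and [T2 / T1 -> 0], so
    for almost every space one of the events
    "[w1(N_n(o)) >= T1] eventually" and
    "[w2(N_k(o)) > 0] and [w2(N_3n(o)) <= T2] eventually" is negligible.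
    As [A] and [B] are separate expectations, nothing is required of the joint
    law of the two weight functions.  *)

From HB Require Import structures.
Require Import Defs.
From mathcomp Require Import all_boot all_order all_algebra.
From mathcomp Require Import all_classical all_reals all_analysis.
From mathcomp Require Import measurable_realfun.
From mathcomp Require Import lra.

Set Implicit Arguments.
Unset Strict Implicit.
Unset Printing Implicit Defensive.

Import Order.TTheory GRing.Theory Num.Theory.
Import numFieldNormedType.Exports.

Local Open Scope classical_set_scope.
Local Open Scope ring_scope.
Local Open Scope quotient_scope.

(** * Finite sums of reals over finite sets *)

Section fsumr.
Context {R : realType} {T : choiceType}.
Implicit Types (A B : set T) (f g : T -> R).

Lemma ler_fsum A f g : finite_set A -> (forall x, A x -> f x <= g x) ->
  \sum_(x \in A) f x <= \sum_(x \in A) g x.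
Proof.
move=> fA fg; rewrite !fsbig_finite//= big_seq [leRHS]big_seq.
by apply: ler_sum => x; rewrite in_fset_set// inE; exact: fg.
Qed.

Lemma ler_fsum_subset A B f : finite_set B -> A `<=` B ->
  (forall x, B x -> 0 <= f x) -> \sum_(x \in A) f x <= \sum_(x \in B) f x.
Proof.
move=> fB AB f0; rewrite (fsbigID A B f fB)//= (setIidr AB) lerDl.
by apply: fsumr_ge0 => x [Bx _]; exact: f0.
Qed.

(** Induction on the number of points: the least of finitely many values is still above [a]. *)
Lemma finite_set_gap A f (a : R) : finite_set A ->
  (forall x, A x -> a < f x) ->
  exists2 e : R, 0 < e & forall x, A x -> a + e < f x.
Proof.
move=> /finite_setP[n]; elim: n A => [|n IH] A.
  by rewrite II0 card_eq0 => /eqP -> _; exists 1.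
move=> /eq_cardSP[x Ax /IH{}IH] af.
have [y [yA _]|e e0 He] := IH; first exact: af.
have xa : 0 < (f x - a) / 2 by rewrite divr_gt0// subr_gt0 af.
(* Half of the excess at the new point [x] keeps the inequality strict there. *)
exists (Num.min e ((f x - a) / 2)); first by rewrite lt_min e0.
move=> y Ay; have [->|/eqP yx] := eqVneq y x.
  apply: (@le_lt_trans _ _ (a + (f x - a) / 2)); last by have := af _ Ax; lra.
  by rewrite lerD2l ge_min lexx orbT.
apply: le_lt_trans (He y _); last by split=> // /yx.
by rewrite lerD2l ge_min lexx.
Qed.

End fsumr.

(** * Closed balls, origins and isomorphism classes *)

Section classes.
Context {R : realType}.

Lemma finite_cball (D : discreteSpace R) (x : D) r : finite_set (cball x r).
Proof. exact: finite_dist_ball. Qed.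

Lemma cballxx (D : discreteSpace R) (x : D) r : 0 <= r -> cball x r x.
Proof. by rewrite /cball/= mdistxx. Qed.

Lemma cball_sym (D : discreteSpace R) (x y : D) r : cball x r y -> cball y r x.
Proof. by rewrite /cball/= metric_sym. Qed.

Lemma cball_triangle (D : discreteSpace R) (x y z : D) r s :
  cball x r y -> cball y s z -> cball x (r + s) z.
Proof.
by move=> xy yz; apply: le_trans (metric_triangle _ y _) _; exact: lerD.
Qed.

(** The ball of radius [r + 1] is finite, so no distance from [x] falls in a short interval just
    above [r]. This makes closed balls stable under small distortions. *)
Lemma cball_gap (D : discreteSpace R) (x : D) r :
  exists2 e, 0 < e & forall y, mdist x y <= r + e -> mdist x y <= r.
Proof.
have [|y [_ /=/negP]|e e0 He] := @finite_set_gap R D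
  (cball x (r + 1) `\` cball x r) (mdist x) r.
- by apply: finite_setD; exact: finite_cball.
- by rewrite -ltNge.
exists (Num.min e 1); first by rewrite lt_min e0/=.
move=> y xy; rewrite leNgt; apply/negP => ry.
suff : r + e < mdist x y.
  by rewrite ltNge => /negP; apply; apply: (le_trans xy); rewrite lerD2l ge_min lexx.
apply: He; split; last by rewrite /cball/= leNgt ry.
by apply: (le_trans xy); rewrite lerD2l ge_min lexx orbT.
Qed.

Lemma tnth_origins_map (Xi : pmetricType R) k (X Y : mspace Xi k) (f : X -> Y) i :
  map f (origins X) = origins Y :> seq Y ->
  f (tnth (origins X) i) = tnth (origins Y) i.
Proof.
move=> fXY; rewrite !(tnth_nth (f (origin X))) -fXY.
by rewrite (nth_map (origin X)) ?size_tuple// -tnth_nth.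
Qed.

Lemma origin_map (Xi : pmetricType R) k (X Y : mspace Xi k) (f : X -> Y) :
  map f (origins X) = origins Y :> seq Y -> f (origin X) = origin Y.
Proof. exact: tnth_origins_map. Qed.

Lemma rep_class_of (Xi : pmetricType R) k (X : mspace Xi k) :
  isomorphic (rep (class_of X)) X.
Proof.
apply: isomorphic_sym; rewrite /rep /class_of.
by have /eqmodP/asboolP := reprK (\pi_(iso_class Xi k) X) => /isomorphic_sym.
Qed.

Lemma class_of_eq (Xi : pmetricType R) k (X Y : mspace Xi k) :
  isomorphic X Y -> class_of X = class_of Y.
Proof. by move=> XY; apply/eqmodP/asboolP. Qed.

End classes.

(** * Open sets of isomorphism classes and semicontinuity of ball sums *)

Section topology.
Context {R : realType}.

(** Conjugation by the two isomorphisms respects origins, distances and marks, so almost embeddings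
    may be tested on any representatives. *)
Lemma almost_embeds_iso (Xi : pmetricType R) k (e : R) (X X' Y Y' : mspace Xi k) :
  isomorphic X X' -> isomorphic Y Y' ->
  almost_embeds e X Y -> almost_embeds e X' Y'.
Proof.
move=> [f [g [[fK gK df] mf fo]]] [f' [g' [[f'K g'K df'] mf' f'o]]].
move=> [h [hi ho hd hm]].
have fX := origin_map fo.
have B x : cball (origin X') e^-1 x -> cball (origin X) e^-1 (g x).
  by rewrite -fX /cball/= -{1}(gK x) df.
exists (f' \o h \o g); split.
- move=> x y; rewrite !inE => /B xB /B yB /= /(can_inj f'K) /hi.
  by rewrite !inE => /(_ xB yB) /(can_inj gK).
- by rewrite -fo -map_comp -f'o -ho -map_comp; apply: eq_map => x /=; rewrite fK.
- by move=> x y /B xB /B yB /=; rewrite df' -{2}(gK x) -{2}(gK y) df; exact: hd.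
- by move=> x y /B xB /B yB /=; rewrite mf' -{2}(gK x) -{2}(gK y) mf; exact: hm.
Qed.

Lemma class_dist_lt_embeds (Xi : pmetricType R) k (c c' : iso_class Xi k) (e : R) :
  e <= 1 -> (class_dist c c' < e%:E)%E -> exists e',
  [/\ 0 < e', e' < e, almost_embeds e' (rep c) (rep c') &
      almost_embeds e' (rep c') (rep c)].
Proof.
move=> e1; rewrite /class_dist /space_dist gt_min lte_fin.
move=> /orP[|]; first by rewrite ltNge e1.
move=> /ereal_inf_lt[_ [e' [e'0 cc' c'c] <-]]; rewrite lte_fin => e'e.
by exists e'.
Qed.

(** Turns openness into a statement on almost embeddings of representatives. The radius is capped at
    1 because [space_dist] is truncated there, so that a larger bound on it carries no
    information. *)
Lemma class_open_rep (Xi : pmetricType R) k (Q : set (mspace Xi k)) :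
  (forall X, Q X -> exists2 e : R, 0 < e & forall Y e', 0 < e' -> e' < e ->
     almost_embeds e' X Y -> almost_embeds e' Y X -> Q Y) ->
  class_open [set c | Q (rep c)].
Proof.
move=> HQ c /HQ[e e0 He]; exists (Num.min e 1); first by rewrite lt_min e0/=.
move=> c' /class_dist_lt_embeds[|e' [e'0]]; first by rewrite ge_min lexx orbT.
by rewrite lt_min => /andP[e'e _]; exact: He.
Qed.

Lemma embeds_class_dist_lt (Xi : pmetricType R) k (c c' : iso_class Xi k) (e e' : R) :
  0 < e' -> e' < e -> almost_embeds e' (rep c) (rep c') ->
  almost_embeds e' (rep c') (rep c) -> (class_dist c c' < e%:E)%E.
Proof.
move=> e'0 e'e cc' c'c; rewrite /class_dist /space_dist.
apply: (@le_lt_trans _ _ e'%:E); last by rewrite lte_fin.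
by rewrite ge_min; apply/orP; right; apply: ereal_inf_lbound; exists e'.
Qed.

Lemma class_open_measurable (Xi : pmetricType R) k (U : set (iso_class Xi k)) :
  class_open U ->
  measurable (U : set (g_sigma_algebraType (@class_open R Xi k))).
Proof. exact: sub_sigma_algebra. Qed.

Section ballsum.
Context {Xi : pmetricType R} (phi : Xi -> R).
Hypothesis phi0 : forall x, 0 <= phi x.
Hypothesis phi_lip : forall x y, phi x <= phi y + mdist x y.

Definition ballsum (r : R) k (X : mspace Xi k) : R :=
  \sum_(v \in cball (origin X) r) phi (mark v v).

Lemma ballsum_ge0 r k (X : mspace Xi k) : 0 <= ballsum r X.
Proof. by apply: fsumr_ge0 => x _; exact: phi0. Qed.

Lemma ballsum_iso r k (X Y : mspace Xi k) :
  isomorphic X Y -> ballsum r X = ballsum r Y.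
Proof.
move=> [f [g [[fK gK df] mf fo]]]; have fX := origin_map fo.
rewrite /ballsum (@reindex_fsbig _ _ _ _ _ f (cball (origin X) r))//.
  by apply: eq_fsbigr => x _; rewrite mf.
split.
- by move=> x /=; rewrite /cball/= -fX df.
- by move=> x y _ _ /(can_inj fK).
- move=> y /=; rewrite /cball/= -fX -(gK y) df => xr.
  by exists (g y) => //; rewrite fK in xr *.
Qed.

(** Upper semicontinuity. An almost embedding of [Y] into [X] is injective on the ball of radius [r]
    and, by the gap of [cball_gap], maps it into the ball of [X] of the same radius. Each term
    changes by at most [e'], so the sum exceeds that of [X] by at most [N * e']. *)
Lemma ballsum_usc r k (X : mspace Xi k) t : ballsum r X < t ->
  exists2 e : R, 0 < e & forall Y e', 0 < e' -> e' < e ->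
    almost_embeds e' Y X -> ballsum r Y < t.
Proof.
move=> Xt; have [d d0 Hd] := cball_gap (origin X) r.
pose N := \sum_(v \in cball (origin X) r) (1 : R).
have N0 : 0 <= N by exact: fsumr_ge0.
(* The three bounds keep the distortion below the gap, make [e'^-1] at least [r], and keep the total
   error [N * e'] below [t - ballsum r X]. *)
pose e := Num.min d (Num.min (`|r| + 1)^-1 ((t - ballsum r X) / (N + 1))).
have r1 : 0 < `|r| + 1 by rewrite ltr_wpDl.
have N1 : 0 < N + 1 by rewrite ltr_wpDl.
exists e; first by rewrite !lt_min d0 invr_gt0 r1 divr_gt0// subr_gt0.
move=> Y e' e'0; rewrite !lt_min => /and3P[e'd e'r e'N] [f [fi fo fd fm]].
have fY := origin_map fo.
have re' : r <= e'^-1.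
  apply: (@le_trans _ _ (`|r| + 1)); first by have := ler_norm r; lra.
  by rewrite -[leLHS]invrK lef_pV2 ?posrE ?invr_gt0// ltW.
have B y : cball (origin Y) r y -> cball (origin Y) e'^-1 y.
  by move=> yr; exact: le_trans yr re'.
have B0 y : cball (origin Y) r y -> cball (origin Y) e'^-1 (origin Y).
  by move=> _; apply: cballxx; rewrite invr_ge0 ltW.
have fB y : cball (origin Y) r y -> cball (origin X) r (f y).
  move=> yr; apply: Hd; rewrite -fY.
  have := fd _ _ (B0 _ yr) (B _ yr); rewrite ler_norml => /andP[_].
  by rewrite lerBlDl => /le_trans -> //; rewrite lerD// ltW.
apply: (@le_lt_trans _ _
  (\sum_(v \in cball (origin Y) r) (phi (mark (f v) (f v)) + e'))).
  apply: ler_fsum => [|y yr]; first exact: finite_cball.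
  apply: (le_trans (phi_lip _ (mark (f y) (f y)))); rewrite lerD2l metric_sym.
  exact: fm (B _ yr) (B _ yr).
apply: (@le_lt_trans _ _
  (\sum_(v \in f @` cball (origin Y) r) (phi (mark v v) + e'))).
  rewrite (@reindex_fsbig _ _ _ _ _ f (cball (origin Y) r))//.
  split=> // x y; rewrite !inE => /B xr /B yr; by apply: fi; rewrite inE.
apply: (@le_lt_trans _ _
  (\sum_(v \in cball (origin X) r) (phi (mark v v) + e'))).
  apply: ler_fsum_subset; first exact: finite_cball.
    by move=> _ [y yr <-]; exact: fB.
  by move=> x _; rewrite addr_ge0// ltW.
rewrite fsbig_split//=; last exact: finite_cball.
have -> : \sum_(v \in cball (origin X) r) e' = N * e'.
  by rewrite mulr_fsuml; apply: eq_fsbigr => *; rewrite mul1r.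
rewrite -ltrBrDl; apply: (@le_lt_trans _ _ ((N + 1) * e')).
  by rewrite ler_wpM2r ?lerDl// ltW.
by rewrite mulrC -ltr_pdivlMr.
Qed.

(** By upper semicontinuity the preimages of the rays below [t] are open, and these rays generate
    the Borel sets. *)
Lemma measurable_ballsum r k : measurable_fun setT
  ((fun c => ballsum r (rep c)) : g_sigma_algebraType (@class_open R Xi k) -> R).
Proof.
apply: (measurability _ (RGenInftyO.measurableE R)).
move=> _ [_ [t ->] <-]; rewrite setTI; apply: class_open_measurable.
have -> : (fun c : iso_class Xi k => ballsum r (rep c)) @^-1` `]-oo, t[ =
  [set c | [set X | ballsum r X < t] (rep c)].
  by apply/seteqP; split => c /=; rewrite in_itv.
apply: class_open_rep => X /= /ballsum_usc[e e0 He]; exists e => //.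
by move=> Y e' e'0 e'e _ ; exact: He.
Qed.

End ballsum.

End topology.

(** * Change of origin *)

Section reroot.
Context {R : realType} {Xi : pmetricType R} {k : nat}.

Definition reroot (i : 'I_k.+1) (X : mspace Xi k) : mspace Xi 0 :=
  MSpace (@mark R Xi k X) [tuple tnth (origins X) i].

Lemma reroot_iso i (X Y : mspace Xi k) :
  isomorphic X Y -> isomorphic (reroot i X) (reroot i Y).
Proof.
move=> [f [g [[fK gK df] mf fo]]]; exists f, g; split => //=.
by rewrite (tnth_origins_map i fo).
Qed.

(** The same map works: by the triangle inequality the ball of radius [e^-1] around the new origin
    lies in the ball of radius [e'^-1] around the old one. *)
Lemma almost_embeds_reroot i (X Y : mspace Xi k) (e e' : R) : e' <= e ->
  mdist (origin X) (tnth (origins X) i) + e^-1 <= e'^-1 ->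
  almost_embeds e' X Y -> almost_embeds e (reroot i X) (reroot i Y).
Proof.
move=> ee' Xe [f [fi fo fd fm]].
have B x : cball (origin (reroot i X)) e^-1 x -> cball (origin X) e'^-1 x.
  move=> xe; apply: le_trans Xe.
  by apply: (@cball_triangle _ _ _ (tnth (origins X) i)); rewrite // /cball/=.
exists f; split => //=.
- by move=> x y; rewrite !inE => /B xe /B ye; apply: fi; rewrite inE.
- by rewrite (tnth_origins_map i fo).
- by move=> x y /B xe /B ye; apply: le_trans ee'; exact: fd.
- by move=> x y /B xe /B ye; apply: le_trans ee'; exact: fm.
Qed.

(** Rerooting is continuous, since the new origin stays at a bounded distance from the old one in
    all nearby spaces. *)
Lemma measurable_reroot i : measurable_fun setT
  ((fun c => class_of (reroot i (rep c))) :
    g_sigma_algebraType (@class_open R Xi k) ->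
    g_sigma_algebraType (@class_open R Xi 0)).
Proof.
apply: (@measurability _ _ _ (g_sigma_algebraType (@class_open R Xi 0)) _ _
  (@class_open R Xi 0)) => //.
move=> _ [U oU <-]; rewrite setTI; apply: class_open_measurable.
have -> : (fun c => class_of (reroot i (rep c))) @^-1` U =
  [set c : iso_class Xi k | [set X | U (class_of (reroot i X))] (rep c)] by [].
apply: class_open_rep => X /= /oU[e e0 He].
pose d := mdist (origin X) (tnth (origins X) i).
have d0 : 0 <= d by exact: mdist_ge0.
have e1 : 0 < e / 2 by rewrite divr_gt0.
have de : 0 < d + 1 + (e / 2)^-1 by rewrite ltr_wpDl ?invr_gt0// addr_ge0.
(* A distortion below 1 puts the new origin of [Y] within [d + 1] of the old one, so the radius
   [d + 1 + (e / 2)^-1] serves both directions. Halving [e] leaves room for the strict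
   inequality. *)
pose e2 := Num.min (Num.min (e / 2) 1) (d + 1 + (e / 2)^-1)^-1.
exists e2; first by rewrite !lt_min e1 ltr01 invr_gt0.
move=> Y e' e'0; rewrite !lt_min -andbA => /and3P[e'e e'1 e'd] XY YX.
have de' : d + 1 + (e / 2)^-1 <= e'^-1.
  by rewrite -[leLHS]invrK lef_pV2 ?posrE ?invr_gt0// ltW.
have dY : mdist (origin Y) (tnth (origins Y) i) <= d + 1.
  case: XY => f [_ fo fd _]; rewrite -(tnth_origins_map i fo) -(origin_map fo).
  have d1 : 0 < (e / 2)^-1 by rewrite invr_gt0.
  have := fd (origin X) (tnth (origins X) i); rewrite ler_norml => /(_ _ _)/andP[].
  - by apply: cballxx; rewrite invr_ge0 ltW.
  - by rewrite /cball/= -/d; lra.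
  by rewrite -/d; lra.
apply: He; apply: (@embeds_class_dist_lt _ _ _ _ _ e (e / 2)) => //; first by lra.
- apply: (almost_embeds_iso (isomorphic_sym (rep_class_of _))
    (isomorphic_sym (rep_class_of _))).
  by apply: almost_embeds_reroot XY; [exact: ltW|rewrite -/d; lra].
- apply: (almost_embeds_iso (isomorphic_sym (rep_class_of _))
    (isomorphic_sym (rep_class_of _))).
  by apply: almost_embeds_reroot YX; [exact: ltW|lra].
Qed.

(** The complement is open: a distance exceeding [n] still does so after a distortion smaller than
    the excess. *)
Lemma measurable_origins_dist i n :
  measurable ([set c | mdist (origin (rep c)) (tnth (origins (rep c)) i) <= n] :
    set (g_sigma_algebraType (@class_open R Xi k))).
Proof.
rewrite -[X in measurable X]setCK; apply: measurableC.
apply: class_open_measurable.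
have -> : ~` [set c : iso_class Xi k |
    mdist (origin (rep c)) (tnth (origins (rep c)) i) <= n] =
  [set c | [set X | n < mdist (origin X) (tnth (origins X) i)] (rep c)].
  by apply/seteqP; split => c /=; rewrite ltNge => /negP.
apply: class_open_rep => X /=; set d := mdist _ _ => nd.
have d0 : 0 <= d by exact: mdist_ge0.
have d1 : 0 < d + 1 by lra.
(* The second bound puts the distinguished point inside the ball on which the embedding controls
   distances. *)
exists (Num.min (d - n) (d + 1)^-1); first by rewrite lt_min subr_gt0 nd invr_gt0.
move=> Y e' e'0; rewrite lt_min => /andP[e'n e'd] [f [_ fo fd _]] _.
have de' : d + 1 <= e'^-1.
  by rewrite -[leLHS]invrK lef_pV2 ?posrE ?invr_gt0// ltW.
rewrite -(tnth_origins_map i fo) -(origin_map fo).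
have := fd (origin X) (tnth (origins X) i); rewrite ler_norml => /(_ _ _)/andP[].
- by apply: cballxx; rewrite invr_ge0 ltW.
- by rewrite /cball/= -/d; lra.
by rewrite -/d; lra.
Qed.

End reroot.

(** * Unmarked pointed and doubly-pointed classes *)

Section pointed.
Context {R : realType}.

Definition dproj (i : 'I_2) (c : dpointed_class R) : pointed_class R :=
  class_of (reroot i (rep c)).

Lemma measurable_dproj i : measurable_fun setT (dproj i).
Proof. exact: measurable_reroot. Qed.

Lemma dproj0 (D : discreteSpace R) (o v : D) : dproj ord0 (dpclass o v) = pclass o.
Proof.
apply/class_of_eq/(isomorphic_trans (reroot_iso _ (rep_class_of _))).
exact: isomorphic_refl.
Qed.

Lemma dproj1 (D : discreteSpace R) (o v : D) : dproj ord_max (dpclass o v) = pclass v.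
Proof.
apply/class_of_eq/(isomorphic_trans (reroot_iso _ (rep_class_of _))).
exact: isomorphic_refl.
Qed.

Definition ddist (c : dpointed_class R) : R :=
  mdist (origin (rep c)) (tnth (origins (rep c)) ord_max).

Lemma ddistE (D : discreteSpace R) (o v : D) : ddist (dpclass o v) = mdist o v.
Proof.
have [f [g [[fK gK df] mf fo]]] := rep_class_of
  (@MSpace R (trivial_mark R) 1 D (fun _ _ => tt) [tuple o; v]).
by rewrite /ddist -df (origin_map fo) (tnth_origins_map _ fo).
Qed.

Lemma measurable_ddist n : measurable [set c | ddist c <= n].
Proof. exact: measurable_origins_dist. Qed.

(** [prep] chooses an arbitrary representative; this isometry carries expectations on [D] over to
    it. *)
Lemma pclass_prep (D : discreteSpace R) (o : D) : exists rho rhoV,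
  @Defs.isometry R D (prep (pclass o)) rho rhoV /\
  rho o = origin (prep (pclass o)).
Proof.
have [f [g [iso mf fo]]] := isomorphic_sym (rep_class_of
  (@MSpace R (trivial_mark R) 0 D (fun _ _ => tt) [tuple o])).
by exists f, g; split => //; rewrite -(origin_map fo).
Qed.

(** The representative carries a marking of its own, but all marks in the one-point space agree. *)
Lemma pclass_origin (c : pointed_class R) : pclass (origin (prep c)) = c.
Proof.
rewrite -[RHS](reprK c); apply: class_of_eq; exists id, id; split => //.
- by move=> x y /=; case: (mark _ _).
- rewrite map_id /prep /rep; case: (repr c) => D m o /=.
  by case/tupleP: o => x o; rewrite (tuple0 o).
Qed.

End pointed.

(** * Measurable functionals of marked pointed spaces *)

Section markings.
Context {R : realType} {Xi : pmetricType R}.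

(** The generators of [marking_measurable], named so that the markings of [D] become a measurable
    type. *)
Definition coordinate_sets (D : discreteSpace R) : set (set (D -> D -> Xi)) :=
  [set E | exists x y (B : set Xi),
    <<s (@open Xi) >> B /\ E = [set m | B (m x y)]].

Definition markings (D : discreteSpace R) :=
  g_sigma_algebraType (@coordinate_sets D).

HB.instance Definition _ (D : discreteSpace R) := Measurable.on (markings D).

(** Two sigma-fields are in play: that on classes, used for the dependence on the class, and that on
    the markings of a fixed space, used to integrate over the extra randomness. An observable is
    measurable for both. *)
Record observable (Phi : mspace Xi 0 -> R) := Observable {
  observable_iso : forall X Y, isomorphic X Y -> Phi X = Phi Y ;
  observable_class : measurable_fun setT
    ((fun c => Phi (rep c)) : mpointed_class Xi -> R) ;
  observable_marking : forall (D : discreteSpace R) (o : D), measurable_fun setT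
    (fun m : markings D => Phi (MSpace m [tuple o]))
}.

Section ballsum.
Variable phi : Xi -> R.
Hypothesis phi0 : forall x, 0 <= phi x.
Hypothesis phi_lip : forall x y, phi x <= phi y + mdist x y.

Lemma open_lipschitz_lt t : open [set x | phi x < t].
Proof.
rewrite openE => x /= xt; apply/nbhs_ballP; exists (t - phi x) => /=.
  by rewrite subr_gt0.
move=> y; rewrite ballEmdist/= => xy; apply: le_lt_trans (phi_lip y x) _.
by rewrite metric_sym; lra.
Qed.

Lemma measurable_marking_at (D : discreteSpace R) (x : D) :
  measurable_fun setT (fun m : markings D => phi (m x x)).
Proof.
apply: (measurability _ (RGenInftyO.measurableE R)).
move=> _ [_ [t ->] <-]; rewrite setTI; apply: sub_sigma_algebra.
exists x, x, [set z | phi z < t]; split.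
  by apply: sub_sigma_algebra; exact: open_lipschitz_lt.
by apply/seteqP; split => m /=; rewrite in_itv.
Qed.

Lemma observable_ballsum r : observable (@ballsum R Xi phi r 0).
Proof.
split.
- exact: ballsum_iso.
- exact: measurable_ballsum.
- move=> D o.
  rewrite (_ : (fun m : markings D => _) =
      fun m => \sum_(v <- finmap.enum_fset (fset_set (cball o r))) phi (m v v)); last first.
    by apply/funext => m; rewrite /ballsum fsbig_finite//; exact: finite_cball.
  by apply: measurable_sum => x; exact: measurable_marking_at.
Qed.

End ballsum.

Lemma observable_comp (h : R -> R) Phi : measurable_fun setT h ->
  observable Phi -> observable (h \o Phi).
Proof.
move=> mh [Pi Pc Pm]; split.
- by move=> X Y XY /=; rewrite (Pi _ _ XY).
- exact: measurableT_comp Pc.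
- by move=> D o; exact: measurableT_comp (Pm D o).
Qed.

Lemma observable_mul Phi Psi :
  observable Phi -> observable Psi -> observable (Phi \* Psi).
Proof.
move=> [Pi Pc Pm] [Qi Qc Qm]; split.
- by move=> X Y XY /=; rewrite (Pi _ _ XY) (Qi _ _ XY).
- exact: measurable_funM.
- by move=> D o; exact: measurable_funM.
Qed.

End markings.

(** * Expectations over the extra randomness *)

Section expectation.
Context {R : realType} {d : measure_display} {Om : discreteSpace R -> measurableType d}.
Context {P : forall D, probability (Om D) R}.
Context {Xi : pmetricType R} (Z : process Om Xi).
Arguments Z : clear implicits.

Definition sampled (D : discreteSpace R) (om : Om D) (o : D) : mspace Xi 0 :=
  MSpace (Z D om) [tuple o].

Definition expect (Phi : mspace Xi 0 -> R) (D : discreteSpace R) (o : D) : \bar R :=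
  (\int[P D]_om (Phi (sampled om o))%:E)%E.

Variable S : set (pointed_class R).
Hypothesis mS : measurable S.
Hypothesis S_measurable : forall (D : discreteSpace R) (o : D), S (pclass o) ->
  forall E, @marking_measurable R Xi D E -> measurable (@Z D @^-1` E).
Hypothesis S_equivariant :
  forall (D1 D2 : discreteSpace R) (rho : D1 -> D2) (rhoV : D2 -> D1) (o : D1),
  S (pclass o) -> Defs.isometry rho rhoV ->
  forall E, @marking_measurable R Xi D2 E ->
  P D1 [set w | E (fun x y => Z D1 w (rhoV x) (rhoV y))] = P D2 [set w | E (Z D2 w)].
Hypothesis S_class : forall A : set (mpointed_class Xi), measurable A ->
  measurable_fun S (fun c => P (prep c)
    [set w | A (mpclass (origin (prep c)) (Z (prep c) w))]).

Variable Phi : mspace Xi 0 -> R.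
Hypothesis oPhi : observable Phi.

Lemma measurable_sampled (D : discreteSpace R) (o : D) : S (pclass o) ->
  measurable_fun setT (fun om : Om D => Phi (sampled om o)).
Proof.
move=> So _ B mB; rewrite setTI.
have := observable_marking oPhi o measurableT mB; rewrite setTI => mE.
by have := S_measurable So mE.
Qed.

(** [rho] is an isomorphism onto [D2] with the transported marking and origin [rho o]; equivariance
    says that the transported marking has the law of [Z D2]. *)
Lemma law_isometry (D1 D2 : discreteSpace R) (rho : D1 -> D2) (rhoV : D2 -> D1)
    (o : D1) (B : set R) : S (pclass o) -> Defs.isometry rho rhoV -> measurable B ->
  P D1 [set om | B (Phi (sampled om o))] =
  P D2 [set om | B (Phi (sampled om (rho o)))].
Proof.
move=> So iso mB.
have := observable_marking oPhi (rho o) measurableT mB; rewrite setTI => mE.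
rewrite -[RHS](S_equivariant So iso mE); congr (P D1 _).
apply/seteqP; suff H om : Phi (sampled om o) =
    Phi (MSpace (fun x y => Z D1 om (rhoV x) (rhoV y)) [tuple rho o]).
  by split => om /=; rewrite /= H.
apply: (observable_iso oPhi); exists rho, rhoV; split=> //.
by case: iso => rhoK _ _ x y /=; rewrite !rhoK.
Qed.

Lemma S_isometry (D1 D2 : discreteSpace R) (rho : D1 -> D2) (rhoV : D2 -> D1) (o : D1) :
  Defs.isometry rho rhoV -> pclass o = pclass (rho o).
Proof. by move=> iso; apply: class_of_eq; exists rho, rhoV. Qed.

Hypothesis Phi0 : forall X, 0 <= Phi X.

Lemma expect_ge0 (D : discreteSpace R) (o : D) : (0 <= expect Phi o)%E.
Proof. by apply: integral_ge0 => om _; rewrite lee_fin. Qed.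

(** Passing to the law of [Phi] reduces expectations to probabilities, the form in which
    equivariance is given. The absolute value makes the integrand nonnegative on the whole line. *)
Lemma expect_law (D : discreteSpace R) (o : D) : S (pclass o) ->
  exists2 nu : {measure set R -> \bar R},
    forall B, nu B = P D [set om | B (Phi (sampled om o))] &
    expect Phi o = (\int[nu]_y `|y|%:E)%E.
Proof.
move=> So; pose X (om : Om D) := Phi (sampled om o).
pose mX := isMeasurableFun.Build _ _ _ _ _ (measurable_sampled So : measurable_fun setT X).
pose Y : {mfun Om D >-> R} := HB.pack X mX.
exists (distribution (P D) Y) => //.
rewrite (ge0_integral_pushforward (measurable_sampled So))//; last first.
  by apply/measurable_EFinP; exact: normr_measurable.
by rewrite preimage_setT; apply: eq_integral => om _ /=; rewrite ger0_norm.
Qed.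

Lemma expect_isometry (D1 D2 : discreteSpace R) (rho : D1 -> D2) (rhoV : D2 -> D1)
    (o : D1) : S (pclass o) -> Defs.isometry rho rhoV ->
  expect Phi o = expect Phi (rho o).
Proof.
move=> So iso; have So' : S (pclass (rho o)) by rewrite -(S_isometry o iso).
have [nu nuE ->] := expect_law So; have [nu' nu'E ->] := expect_law So'.
apply: eq_measure_integral => /= B mB _; rewrite nuE nu'E.
exact: law_isometry So iso mB.
Qed.

Lemma measurable_prob (B : set R) : measurable B ->
  measurable_fun S (fun c => P (prep c)
    [set om | B (Phi (sampled om (origin (prep c))))]).
Proof.
move=> mB.
have := observable_class oPhi measurableT mB; rewrite setTI => mA.
rewrite (_ : (fun c => _) = fun c => P (prep c) [set om |
  [set c' | B (Phi (rep c'))] (mpclass (origin (prep c)) (Z (prep c) om))]).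
  exact: S_class mA.
apply/funext => c; congr (P _ _).
apply/seteqP; split => om /=;
  by rewrite (observable_iso oPhi (rep_class_of (sampled om _))).
Qed.

(** The laws of [Phi] depend measurably on the class, so they form a kernel, against which the
    absolute value is integrated. *)
Lemma measurable_expect :
  measurable_fun S (fun c => expect Phi (origin (prep c))).
Proof.
have /choice[l lE] : forall c, exists nu : {measure set R -> \bar R},
    (forall B, nu B = ((fun c => P (prep c)
      [set om | B (Phi (sampled om (origin (prep c))))]) \_ S) c) /\
    (S c -> expect Phi (origin (prep c)) = \int[nu]_y `|y|%:E)%E.
  move=> c; have [Sc|nSc] := pselect (S c); last first.
    (* Off [S] the zero measure completes the kernel. *)
    by exists mzero; split=> // B; rewrite patchE memNset.
  have [|nu nuE ->] := @expect_law _ (origin (prep c)).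
    by rewrite pclass_origin.
  by exists nu; split=> // B; rewrite nuE patchE mem_set.
have ml B : measurable B -> measurable_fun setT (l ^~ B).
  move=> mB; under eq_fun do rewrite (lE _).1.
  by apply/(measurable_restrictT _ mS); exact: measurable_prob.
have mabs : measurable_fun setT (fun y : R => `|y|%:E).
  by apply/measurable_EFinP; exact: normr_measurable.
have abs0 (y : R) : (0 <= `|y|%:E)%E by rewrite lee_fin.
have := measurable_fun_integral_kernel ml abs0 mabs.
move=> /(measurable_funTS (D := S)); apply: eq_measurable_fun => c /set_mem Sc.
by rewrite (lE c).2.
Qed.

End expectation.

(** * Integrals and sums of nonnegative functions *)

Section auxiliary.
Local Open Scope ereal_scope.

(* No measurability: the integral of a nonnegative function is a supremum over
   the simple functions below it. *)
Lemma le_integral_ge0 d (T : measurableType d) (R : realType)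
    (mu : {measure set T -> \bar R}) (f g : T -> \bar R) :
  (forall x, 0 <= f x) -> (forall x, f x <= g x) ->
  \int[mu]_x f x <= \int[mu]_x g x.
Proof.
move=> f0 fg; rewrite !ge0_integralTE//; last first.
  by move=> x; exact: le_trans (fg x).
apply: le_ereal_sup => _ [h hf <-]; exists h => // x.
exact: le_trans (hf x) (fg x).
Qed.

Lemma esum_indicator (R : realType) (T : choiceType) (A : set T) (f : T -> \bar R) :
  finite_set A -> (forall x, 0 <= f x) -> (forall x, ~ A x -> f x = 0) ->
  \esum_(x in [set: T]) f x = \sum_(x \in A) f x.
Proof.
move=> fA f0 fNA; rewrite -esum_fset//.
rewrite [RHS]esum_mkcond; apply: eq_esum => x _.
by case: ifPn => // /negP xA; apply: fNA => Ax; apply: xA; exact: mem_set.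
Qed.

End auxiliary.

(** * Mass estimates on a fixed space *)

Section deterministic.
Context {R : realType} (D : discreteSpace R).

Definition ncball (v : D) (r : R) : R := \sum_(x \in cball v r) (1 : R).

Lemma ncball_gt0 v r : 0 <= r -> 0 < ncball v r.
Proof.
move=> r0; apply: (@lt_le_trans _ _ (\sum_(x \in [set v]) (1 : R))).
  by rewrite fsbig_set1.
apply: ler_fsum_subset => //; first exact: finite_cball.
by move=> _ ->; exact: cballxx.
Qed.

Variable w : D -> R.
Hypothesis w0 : forall v, 0 <= w v.

(** Bounds the mass entering [o]. The weight of [x] is divided among the points [v] of [cball x k]
    with shares adding up to at most 1, and all [x] involved lie in a single ball of weight at most
    [T]. *)
Lemma spread_le (o : D) (k n T : R) : 0 <= k -> k <= n -> 0 <= T ->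
  \sum_(v \in cball o n)
     (\sum_(x \in cball v k) w x) *
     (\sum_(x \in cball v (3 * n)) w x <= T)%R%:R / ncball v (2 * k) <= T.
Proof.
move=> k0 kn T0.
(* Without such a [v0] every indicator vanishes. With one, its ball of radius [3 * n] contains
   [cball o (n + k)], because [2 * n + k <= 3 * n]. *)
have [[v0 [v0n v0T]]|nv0] := pselect (exists v0, cball o n v0 /\
    \sum_(x \in cball v0 (3 * n)) w x <= T); last first.
  rewrite fsbig1// => v vn; case: (leP _ T) => vT; last by rewrite mulr0 mul0r.
  by exfalso; apply: nv0; exists v.
apply: le_trans v0T.
have fB v r := @finite_cball R D v r.
apply: (@le_trans _ _ (\sum_(v \in cball o n) \sum_(x \in cball o (n + k))
    (w x * ((v \in cball x k)%:R / ncball v (2 * k))))).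
  apply: ler_fsum => // v vn.
  apply: (@le_trans _ _ ((\sum_(x \in cball v k) w x) / ncball v (2 * k))).
    apply: ler_wpM2r.
      by rewrite invr_ge0 ltW// ncball_gt0//; lra.
    apply: ler_piMr; first exact: fsumr_ge0.
    by rewrite lern1 leq_b1.
  rewrite mulr_fsuml.
  have kv : cball v k `<=` cball o (n + k) by move=> x; exact: cball_triangle.
  rewrite (eq_fsbigr (fun x => w x * ((v \in cball x k)%:R / ncball v (2 * k)))).
    apply: ler_fsum_subset => // x _; rewrite mulr_ge0// divr_ge0//.
    by rewrite ltW// ncball_gt0; lra.
  move=> x /set_mem /cball_sym xk; rewrite (mem_set xk) mul1r//.
rewrite exchange_fsbig//.
apply: (@le_trans _ _ (\sum_(x \in cball o (n + k)) w x)); last first.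
  apply: ler_fsum_subset => // x xnk.
  have := cball_triangle (cball_sym v0n) xnk; rewrite /cball/= => /le_trans -> //.
  lra.
apply: ler_fsum => // x _; rewrite -mulr_fsumr ler_piMr//.
(* For [v] in [cball x k] one has [cball x k] inside [cball v (2 * k)], so each share is at most
   [(ncball x k)^-1]. *)
apply: (@le_trans _ _ (\sum_(v \in cball o n `&` cball x k) (ncball x k)^-1)).
  rewrite fsbig_mkcondr; apply: ler_fsum => // v _.
  case: ifPn => [/set_mem xv|_]; last by rewrite mul0r.
  rewrite mul1r lef_pV2 ?posrE ?ncball_gt0//; last lra.
  apply: ler_fsum_subset => // y xy.
  rewrite (_ : 2 * k = k + k); last lra.
  exact: cball_triangle (cball_sym xv) xy.
apply: (@le_trans _ _ (\sum_(v \in cball x k) (ncball x k)^-1)).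
  apply: ler_fsum_subset => // v _.
  by rewrite invr_ge0 ltW// ncball_gt0.
rewrite (eq_fsbigr (fun v => 1 * (ncball x k)^-1)); last by move=> *; rewrite mul1r.
by rewrite -mulr_fsuml mulfV// gt_eqF// ncball_gt0.
Qed.

(** Either one term reaches [T], and its truncation alone suffices, or truncation changes no
    term. *)
Lemma sum_min_ge (A : set D) (T : R) : finite_set A -> 0 <= T ->
  T <= \sum_(v \in A) w v -> T <= \sum_(v \in A) Num.min (w v) T.
Proof.
move=> fA T0 TA.
have [[v [Av vT]]|nv] := pselect (exists v, A v /\ T <= w v).
  apply: (@le_trans _ _ (\sum_(x \in [set v]) Num.min (w x) T)).
    by rewrite fsbig_set1 min_r.
  apply: ler_fsum_subset => //; first by move=> _ ->.
  by move=> x _; rewrite le_min w0.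
apply: (le_trans TA); apply: ler_fsum => // v Av; rewrite le_min lexx/=.
by rewrite leNgt; apply/negP => /ltW Tv; apply: nv; exists v.
Qed.

End deterministic.

(** * Equivariance on a given set and real-valued expectations *)

Section equivariant_on.
Context {R : realType} {d : measure_display} {Om : discreteSpace R -> measurableType d}.
Context (P : forall D, probability (Om D) R).
Context {Xi : pmetricType R}.

(** Here [S] is a parameter, so that it can be shrunk to a set common to two processes. *)
Definition equivariant_on (S : set (pointed_class R)) (Z : process Om Xi) :=
  [/\ measurable S,
      forall (D : discreteSpace R) (o : D), S (pclass o) ->
        forall E, @marking_measurable R Xi D E -> measurable (@Z D @^-1` E),
      forall (D1 D2 : discreteSpace R) (rho : D1 -> D2) (rhoV : D2 -> D1) (o : D1),
        S (pclass o) -> Defs.isometry rho rhoV ->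
        forall E, @marking_measurable R Xi D2 E ->
        P D1 [set w | E (fun x y => @Z D1 w (rhoV x) (rhoV y))] =
        P D2 [set w | E (@Z D2 w)] &
      forall A : set (mpointed_class Xi), measurable A ->
        measurable_fun S (fun c => P (prep c)
          [set w | A (mpclass (origin (prep c)) (@Z (prep c) w))])].

Lemma equivariant_onS S S' Z : measurable S' -> S' `<=` S ->
  equivariant_on S Z -> equivariant_on S' Z.
Proof.
move=> mS' SS' [mS Zm Ze Zc]; split=> //.
- by move=> D o /SS'; exact: Zm.
- by move=> D1 D2 rho rhoV o /SS'; exact: Ze.
- by move=> A mA; apply: measurable_funS (Zc _ mA).
Qed.

Variables (S : set (pointed_class R)) (Z : process Om Xi).
Hypothesis eZ : equivariant_on S Z.

(** [unimodular] tests real functions measurable on the whole space; hence [fine], and the value 0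
    off [S]. *)
Definition rexpect (Phi : mspace Xi 0 -> R) (c : pointed_class R) : R :=
  if c \in S then fine (expect (P := P) Z Phi (origin (prep c))) else 0.

Variable Phi : mspace Xi 0 -> R.
Hypothesis oPhi : observable Phi.
Hypothesis Phi0 : forall X, 0 <= Phi X.

Lemma measurable_sampled_on (D : discreteSpace R) (o : D) : S (pclass o) ->
  measurable_fun setT (fun om : Om D => Phi (sampled Z om o)).
Proof. by case: eZ => mS Zm Ze Zc; exact: measurable_sampled. Qed.

Lemma measurable_rexpect : measurable_fun setT (rexpect Phi).
Proof.
case: eZ => mS Zm Ze Zc.
have := measurable_expect mS Zm Zc oPhi Phi0 => /(measurable_restrictT _ mS).1.
move=> /(measurableT_comp (@fine_measurable R setT measurableT)).
apply: eq_measurable_fun => c _ /=; rewrite /rexpect patchE.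
by case: ifP.
Qed.

Lemma rexpect_ge0 c : 0 <= rexpect Phi c.
Proof. by rewrite /rexpect; case: ifP => // _; rewrite fine_ge0// expect_ge0. Qed.

Lemma rexpect_notin c : ~ S c -> rexpect Phi c = 0.
Proof. by move=> nSc; rewrite /rexpect memNset. Qed.

Variable M : R.
Hypothesis PhiM : forall X, Phi X <= M.

Lemma expect_le (D : discreteSpace R) (o : D) : S (pclass o) ->
  (expect (P := P) Z Phi o <= M%:E)%E.
Proof.
move=> So; have M0 : 0 <= M by exact: le_trans (Phi0 _) (PhiM (rep point)).
apply: (@le_trans _ _ (\int[P D]_om (cst M%:E om))%E).
  by apply: le_integral_ge0 => om; rewrite lee_fin.
by rewrite integral_cst// [X in (_ * X)%E](probability_setT (P D)) mule1.
Qed.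

(** Boundedness of [Phi] makes the expectation finite, so [fine] loses nothing; equivariance moves
    it from the chosen representative to [D]. *)
Lemma rexpectE (D : discreteSpace R) (o : D) : S (pclass o) ->
  ((rexpect Phi (pclass o))%:E = expect (P := P) Z Phi o)%E.
Proof.
move=> So; rewrite /rexpect mem_set//.
have [rho [rhoV [iso <-]]] := pclass_prep o.
case: eZ => mS Zm Ze Zc.
rewrite -(expect_isometry Zm Ze oPhi Phi0 So iso) fineK//.
by rewrite ge0_fin_numE ?expect_ge0//; apply: le_lt_trans (expect_le So) (ltry _).
Qed.

End equivariant_on.

(** * Functionals of the weights *)

Section weights.
Context {R : realType}.
Implicit Types (X : mspace (nnreal R) 0).

Definition mass (r : R) X : R := ballsum (@nnval R) r X.

Definition truncated_mass (T r : R) X : R :=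
  ballsum (fun x : nnreal R => Num.min (nnval x) T) r X.

Lemma nnval_ge0 (x : nnreal R) : 0 <= nnval x.
Proof. by rewrite /nnval; exact: ge0. Qed.

Lemma nnval_lipschitz (x y : nnreal R) : nnval x <= nnval y + mdist x y.
Proof. by rewrite -lerBlDl; exact: ler_norm. Qed.

Lemma truncated_nnval_lipschitz (T : R) (x y : nnreal R) :
  Num.min (nnval x) T <= Num.min (nnval y) T + mdist x y.
Proof.
have xy := nnval_lipschitz x y; have xy0 : 0 <= mdist x y by exact: mdist_ge0.
by case: (leP (nnval x) T) => ?; case: (leP (nnval y) T) => ?; lra.
Qed.

Lemma mass_ge0 r X : 0 <= mass r X.
Proof. by apply: ballsum_ge0; exact: nnval_ge0. Qed.

Lemma mass_le r s X : r <= s -> mass r X <= mass s X.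
Proof.
move=> rs; apply: ler_fsum_subset; first exact: finite_cball.
  by move=> x xr; exact: le_trans xr rs.
by move=> x _; exact: nnval_ge0.
Qed.

Lemma cball0 (D : discreteSpace R) (o : D) : cball o 0 = [set o].
Proof.
apply/seteqP; split=> [x /= xo|_ ->]; last exact: cballxx.
apply/esym/mdist_positivity/le_anti; rewrite mdist_ge0 andbT; exact: xo.
Qed.

Lemma truncated_mass0 T X :
  truncated_mass T 0 X = Num.min (nnval (mark (origin X) (origin X))) T.
Proof. by rewrite /truncated_mass /ballsum cball0 fsbig_set1. Qed.

Lemma observable_mass r : observable (mass r).
Proof. by apply: observable_ballsum; [exact: nnval_ge0|exact: nnval_lipschitz]. Qed.

Lemma observable_truncated_mass T r : 0 <= T -> observable (truncated_mass T r).
Proof.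
move=> T0; apply: observable_ballsum; last exact: truncated_nnval_lipschitz.
by move=> x; rewrite le_min nnval_ge0.
Qed.

(** Under [w1] its expectation is the probability [P[w1(N_n(o)) >= T1]]; under [w2] the expectation
    of [light] is the numerator of [A(o)]. *)
Definition heavy (T r : R) X : R := (T <= mass r X)%R%:R.

Definition light (k r T : R) X : R := mass k X * (mass r X <= T)%R%:R.

Lemma observable_heavy T r : observable (heavy T r).
Proof.
rewrite (_ : heavy T r = \1_(`[T, +oo[%classic) \o mass r).
  by apply: observable_comp (observable_mass r); exact: measurable_indic.
by apply/funext => X; rewrite /= indicE mem_setE in_itv/= andbT.
Qed.

Lemma observable_light k r T : observable (light k r T).
Proof.
apply: observable_mul; first exact: observable_mass.
rewrite (_ : (fun X => _) = \1_(`]-oo, T]%classic) \o mass r).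
  by apply: observable_comp (observable_mass r); exact: measurable_indic.
by apply/funext => X; rewrite /= indicE mem_setE in_itv.
Qed.

Lemma heavy_ge0 T r X : 0 <= heavy T r X.
Proof. exact: ler0n. Qed.

Lemma heavy_le1 T r X : heavy T r X <= 1.
Proof. by rewrite lern1 leq_b1. Qed.

Lemma light_ge0 k r T X : 0 <= light k r T X.
Proof. by rewrite mulr_ge0// mass_ge0. Qed.

Lemma light_le k r T X : k <= r -> 0 <= T -> light k r T X <= T.
Proof.
move=> kr T0; rewrite /light; case: (leP (mass r X) T) => XT; last by rewrite mulr0.
by rewrite mulr1; apply: le_trans XT; exact: mass_le.
Qed.

End weights.

(** * Cardinality of balls as a function of the class *)

Section counting.
Context {R : realType}.

Definition ncballc (r : R) (c : pointed_class R) : R := ncball (origin (prep c)) r.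

Lemma measurable_ncballc r : measurable_fun setT (ncballc r).
Proof.
apply: (@measurable_ballsum R (trivial_mark R) (fun=> 1)) => // x y.
by rewrite lerDl mdist_ge0.
Qed.

Lemma ncballc_pclass r (D : discreteSpace R) (o : D) :
  ncballc r (pclass o) = ncball o r.
Proof. exact: (ballsum_iso (fun=> 1) r (rep_class_of _)). Qed.

End counting.

(** * The mass transport *)

Section transport.
Context {R : realType} {d : measure_display} {Om : discreteSpace R -> measurableType d}.
Context {P : forall D, probability (Om D) R} {mu : probability (pointed_class R) R}.
Variables (S : set (pointed_class R)) (w1 w2 : weight_process Om).
Hypothesis mu_unimodular : unimodular mu.
Hypothesis S_origin : forall (D : discreteSpace R) (o o' : D),
  S (pclass o) -> S (pclass o').
Hypothesis e1 : equivariant_on P S w1.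
Hypothesis e2 : equivariant_on P S w2.

Lemma massE (w : weight_process Om) (D : discreteSpace R) (om : Om D) (o : D) r :
  mass r (sampled w om o) = weight_set w om (cball o r).
Proof. by []. Qed.

Lemma weight_ge0 (w : weight_process Om) (D : discreteSpace R) (om : Om D) (v : D) :
  0 <= weight w om v.
Proof. exact: nnval_ge0. Qed.

Variables (k n T1 T2 : R).
Hypotheses (k0 : 0 <= k) (kn : k <= n) (T10 : 0 <= T1) (T20 : 0 <= T2).

(** [sender] is [A] and [receiver] is [B]. In the latter the radius 0 reduces the ball to its
    centre. *)
Definition sender (c : pointed_class R) : R :=
  rexpect P S w2 (light k (3 * n) T2) c / ncballc (2 * k) c.

Definition receiver (c : pointed_class R) : R :=
  rexpect P S w1 (truncated_mass T1 0) c.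

Let obsT r : observable (truncated_mass T1 r) := observable_truncated_mass r T10.

Let k3n : k <= 3 * n. Proof. by move: k0 kn => ? ?; lra. Qed.

Let ball2k0 (D : discreteSpace R) (v : D) : 0 < ncball v (2 * k).
Proof. by apply: ncball_gt0; move: k0 => ?; lra. Qed.

Lemma truncated_mass_ge0 r X : 0 <= truncated_mass T1 r X.
Proof. by apply: ballsum_ge0 => x; rewrite le_min nnval_ge0. Qed.

Lemma truncated_mass0_le X : truncated_mass T1 0 X <= T1.
Proof. by rewrite truncated_mass0 ge_min lexx orbT. Qed.

Lemma sender_ge0 c : 0 <= sender c.
Proof.
rewrite /sender divr_ge0 ?rexpect_ge0//; first exact: light_ge0.
by rewrite ltW// ball2k0.
Qed.

Lemma receiver_ge0 c : 0 <= receiver c.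
Proof. by apply: rexpect_ge0 => X; exact: truncated_mass_ge0. Qed.

Lemma measurable_sender : measurable_fun setT sender.
Proof.
apply: measurable_funM.
  by apply: (measurable_rexpect e2); [exact: observable_light|exact: light_ge0].
(* On positive reals inversion is the power with exponent -1, a measurable function. *)
rewrite (_ : (fun c => _) = (fun x : R => x `^ (- 1)) \o ncballc (2 * k)).
  by apply: measurableT_comp (measurable_ncballc _); exact: measurable_powR.
by apply/funext => c /=; rewrite powR_inv1// ltW// ball2k0.
Qed.

Lemma measurable_receiver : measurable_fun setT receiver.
Proof.
by apply: (measurable_rexpect e1); [exact: obsT|exact: truncated_mass_ge0].
Qed.

(** Linearity moves the sum inside the expectation, where [sum_min_ge] applies to every realization
    of [w1]. *)
Lemma sum_receiver_ge (D : discreteSpace R) (o : D) : S (pclass o) ->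
  T1 * rexpect P S w1 (heavy T1 n) (pclass o) <=
  \sum_(v \in cball o n) receiver (pclass v).
Proof.
move=> So; rewrite -lee_fin EFinM -fsumEFin; last exact: finite_cball.
rewrite (rexpectE e1 (observable_heavy _ _) (@heavy_ge0 R T1 n) (@heavy_le1 R T1 n) So).
have -> : (\sum_(v \in cball o n) (receiver (pclass v))%:E =
    \sum_(v \in cball o n) \int[P D]_om (truncated_mass T1 0 (sampled w1 om v))%:E)%E.
  apply: eq_fsbigr => v _; apply: rexpectE => //.
  - exact: truncated_mass_ge0.
  - exact: truncated_mass0_le.
  - exact: S_origin So.
rewrite -ge0_integral_fsum//; last 3 first.
- move=> v; apply/measurable_EFinP; apply: (measurable_sampled_on e1) => //.
  exact: S_origin So.
- by move=> v om _; rewrite lee_fin truncated_mass_ge0.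
- exact: finite_cball.
rewrite /expect -ge0_integralZl//; last 2 first.
- apply/measurable_EFinP; apply: (measurable_sampled_on e1) => //.
  exact: observable_heavy.
- by move=> om _; rewrite lee_fin heavy_ge0.
apply: le_integral_ge0 => om; first by rewrite mule_ge0// lee_fin heavy_ge0.
rewrite fsumEFin; last exact: finite_cball.
rewrite -EFinM lee_fin /heavy massE; case: (leP T1 (weight_set _ _ _)) => om1; last first.
  by rewrite mulr0; apply: fsumr_ge0 => v _; exact: truncated_mass_ge0.
rewrite mulr1; under eq_fsbigr do rewrite truncated_mass0.
apply: (@sum_min_ge R D (weight w1 om)) => //.
- exact: weight_ge0.
- exact: finite_cball.
Qed.

(** Linearity again, then [spread_le] for every realization of [w2]. *)
Lemma sum_sender_le (D : discreteSpace R) (o : D) : S (pclass o) ->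
  \sum_(v \in cball o n) sender (pclass v) <= T2.
Proof.
move=> So; rewrite -lee_fin -fsumEFin; last exact: finite_cball.
have -> : (\sum_(v \in cball o n) (sender (pclass v))%:E =
    \sum_(v \in cball o n) \int[P D]_om
      (light k (3 * n) T2 (sampled w2 om v) / ncball v (2 * k))%:E)%E.
  apply: eq_fsbigr => v _; rewrite /sender ncballc_pclass EFinM.
  have Sv := S_origin v So.
  rewrite (rexpectE e2 (observable_light _ _ _) (@light_ge0 R _ _ _)
    (fun X => light_le X k3n T20) Sv).
  rewrite -ge0_integralZr//.
  - apply/measurable_EFinP; apply: (measurable_sampled_on e2) => //.
    exact: observable_light.
  - by move=> om _; rewrite lee_fin light_ge0.
  - by rewrite lee_fin invr_ge0 ltW.
rewrite -ge0_integral_fsum//; last 3 first.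
- move=> v; apply/measurable_EFinP; apply: measurable_funM => //.
  apply: (measurable_sampled_on e2); first exact: observable_light.
  exact: S_origin So.
- by move=> v om _; rewrite lee_fin divr_ge0 ?light_ge0 ?ltW.
- exact: finite_cball.
apply: (@le_trans _ _ (\int[P D]_om (cst T2%:E om))%E); last first.
  by rewrite integral_cst// [X in (_ * X)%E](probability_setT (P D)) mule1.
apply: le_integral_ge0 => om.
  by apply: fsume_ge0 => v _; rewrite lee_fin divr_ge0 ?light_ge0 ?ltW.
rewrite fsumEFin; last exact: finite_cball.
by rewrite lee_fin; apply: (@spread_le R D (weight w2 om)) => // v; exact: weight_ge0.
Qed.

Let send (c : dpointed_class R) : R :=
  sender (dproj ord0 c) * receiver (dproj ord_max c) * (ddist c <= n)%R%:R.

Let send_ge0 c : 0 <= send c.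
Proof.
by apply: mulr_ge0 => //; apply: mulr_ge0; [exact: sender_ge0|exact: receiver_ge0].
Qed.

Let measurable_send : measurable_fun setT send.
Proof.
apply: measurable_funM; first apply: measurable_funM.
- by apply: measurableT_comp (measurable_dproj _); exact: measurable_sender.
- by apply: measurableT_comp (measurable_dproj _); exact: measurable_receiver.
rewrite (_ : (fun c => _) = \1_[set c | ddist c <= n]).
  by apply: measurable_indic; exact: measurable_ddist.
by apply/funext => c; rewrite indicE mem_setE.
Qed.

Let sendE (D : discreteSpace R) (o v : D) : send (dpclass o v) =
  sender (pclass o) * receiver (pclass v) * (mdist o v <= n)%R%:R.
Proof. by rewrite /send dproj0 dproj1 ddistE. Qed.

Let mass_out c :
  ((T1 * (sender c * rexpect P S w1 (heavy T1 n) c))%:E <=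
   \esum_(v in [set: prep c]) (send (dpclass (origin (prep c)) v))%:E)%E.
Proof.
set o := origin (prep c).
(* Off [S] the convention [rexpect = 0] makes the left side vanish. *)
have [Sc|nSc] := pselect (S c); last first.
  rewrite rexpect_notin// !mulr0; apply: esum_ge0 => v _.
  by rewrite lee_fin send_ge0.
rewrite (@esum_indicator _ _ (cball o n)); first last.
- by move=> v vn; rewrite sendE (negbTE (introN idP vn)) mulr0.
- by move=> v; rewrite lee_fin send_ge0.
- exact: finite_cball.
rewrite fsumEFin; last exact: finite_cball.
rewrite lee_fin (eq_fsbigr (fun v => sender c * receiver (pclass v))); last first.
  by move=> v /set_mem vn; rewrite sendE pclass_origin (introT idP vn) mulr1.
rewrite -mulr_fsumr mulrCA ler_wpM2l ?sender_ge0//.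
by rewrite -[in leLHS](pclass_origin c) sum_receiver_ge// pclass_origin.
Qed.

Let mass_in c :
  (\esum_(v in [set: prep c]) (send (dpclass v (origin (prep c))))%:E <=
   (T2 * receiver c)%:E)%E.
Proof.
set o := origin (prep c).
rewrite (@esum_indicator _ _ (cball o n)); first last.
- move=> v vn; rewrite sendE metric_sym.
  by rewrite (negbTE (introN idP vn)) mulr0.
- by move=> v; rewrite lee_fin send_ge0.
- exact: finite_cball.
rewrite fsumEFin; last exact: finite_cball.
rewrite lee_fin (eq_fsbigr (fun v => sender (pclass v) * receiver c)); last first.
  move=> v /set_mem vn.
  by rewrite sendE pclass_origin metric_sym (introT idP vn) mulr1.
rewrite -mulr_fsuml; have [Sc|nSc] := pselect (S c); last first.
  by rewrite /receiver rexpect_notin// !mulr0.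
by rewrite ler_wpM2r ?receiver_ge0// sum_sender_le// pclass_origin.
Qed.

(** Unimodularity equates the expected outgoing and incoming masses, bounded from below by
    [mass_out] and from above by [mass_in]. *)
Lemma transport_bound :
  (T1%:E * (\int[mu]_c (sender c * rexpect P S w1 (heavy T1 n) c)%:E) <=
   T2%:E * mean_weight P mu w1)%E.
Proof.
have p0 c : 0 <= rexpect P S w1 (heavy T1 n) c.
  by apply: rexpect_ge0; exact: heavy_ge0.
rewrite -ge0_integralZl//; last 2 first.
- apply/measurable_EFinP; apply: measurable_funM; first exact: measurable_sender.
  by apply: (measurable_rexpect e1); [exact: observable_heavy|exact: heavy_ge0].
- by move=> c _; rewrite lee_fin mulr_ge0 ?sender_ge0.
apply: (@le_trans _ _ (\int[mu]_c
    \esum_(v in [set: prep c]) (send (dpclass (origin (prep c)) v))%:E)%E).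
  apply: le_integral_ge0 => c; last by rewrite -EFinM; exact: mass_out.
  by rewrite -EFinM lee_fin; do 2!apply: mulr_ge0 => //; exact: sender_ge0.
rewrite mu_unimodular//.
apply: (@le_trans _ _ (\int[mu]_c (T2%:E * (receiver c)%:E))%E).
  apply: le_integral_ge0 => c; last by rewrite -EFinM; exact: mass_in.
  by apply: esum_ge0 => v _; rewrite lee_fin send_ge0.
rewrite ge0_integralZl//; last 2 first.
- by apply/measurable_EFinP; exact: measurable_receiver.
- by move=> c _; rewrite lee_fin receiver_ge0.
apply: lee_wpmul2l; first by rewrite lee_fin.
apply: le_integral_ge0 => c; first by rewrite lee_fin receiver_ge0.
have w0 : (0 <= \int[P (prep c)]_om (weight w1 om (origin (prep c)))%:E)%E.
  by apply: integral_ge0 => om _; rewrite lee_fin weight_ge0.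
(* Off [S] the receiver is 0; on [S] truncation only lowers the weight of the origin. *)
have [Sc|nSc] := pselect (S c); last by rewrite /receiver rexpect_notin.
have So : S (pclass (origin (prep c))) by rewrite pclass_origin.
rewrite -[X in receiver X]pclass_origin /receiver.
rewrite (rexpectE e1 (obsT 0) (@truncated_mass_ge0 0) truncated_mass0_le So).
apply: le_integral_ge0 => om; rewrite lee_fin ?truncated_mass_ge0//.
by rewrite truncated_mass0 ge_min lexx.
Qed.

End transport.

(** * Growth rates and power bounds *)

Section growth.
Context {R : realType}.
Implicit Types (f : R -> R) (a b : R).

(** Rational exponents keep the number of exceptional null sets countable. *)
Lemma lt_ereal_rat (x y : \bar R) : (x < y)%E ->
  exists q : rat, (x < (ratr q : R)%:E)%E /\ ((ratr q : R)%:E < y)%E.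
Proof.
case: x y => [x| |] [y| |]//.
- by rewrite lte_fin => /rat_in_itvoo[q /itvP qxy]; exists q; rewrite !lte_fin !qxy.
- have /rat_in_itvoo[q /itvP qx] : x < x + 1 by rewrite ltrDl.
  by exists q; rewrite lte_fin qx ltry.
- have /rat_in_itvoo[q /itvP qy] : y - 1 < y by rewrite gtrBl.
  by exists q; rewrite lte_fin qy ltNyr.
- by exists 0; rewrite ltNyr ltry.
Qed.

Lemma limf_esup_lt (g : R -> \bar R) (x : \bar R) :
  (limf_esup g (pinfty_nbhs R) < x)%E -> \forall r \near +oo, (g r < x)%E.
Proof.
rewrite limf_esupE => /ereal_inf_lt[_ [V FV <-] Vx].
by apply: filterS FV => r Vr; apply: le_lt_trans Vx; apply: ereal_sup_ubound; exists r.
Qed.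

Lemma limf_einf_gt (g : R -> \bar R) (x : \bar R) :
  (x < limf_einf g (pinfty_nbhs R))%E -> \forall r \near +oo, (x < g r)%E.
Proof.
rewrite /limf_einf lteNr => /limf_esup_lt.
by apply: filterS => r; rewrite lteN2.
Qed.

Lemma growth_sup_lt f a : (growth_sup f < a%:E)%E ->
  \forall r \near +oo, f r <= expR (a * ln r).
Proof.
move=> /limf_esup_lt fa; near=> r.
have r1 : 1 < r by near: r; exact: nbhs_pinfty_gt.
have lr : 0 < ln r by exact: ln_gt0.
have : (log_ratio f r < a%:E)%E by near: r.
have [fr0 _|fr0] := leP (f r) 0; first exact: le_trans fr0 (ltW (expR_gt0 _)).
rewrite /log_ratio lne_EFin// -EFinM lte_fin ltr_pdivrMr// => /ltW h.
by rewrite -[leLHS]lnK ?posrE// ler_expR.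
Unshelve. all: by end_near. Qed.

Lemma growth_inf_gt f b : (b%:E < growth_inf f)%E ->
  \forall r \near +oo, expR (b * ln r) <= f r.
Proof.
move=> /limf_einf_gt fb; near=> r.
have r1 : 1 < r by near: r; exact: nbhs_pinfty_gt.
have lr : 0 < ln r by exact: ln_gt0.
have : (b%:E < log_ratio f r)%E by near: r.
rewrite /log_ratio; have [fr0|fr0] := leP (f r) 0.
  (* Here [lne] is [-oo], and so is the ratio since [ln r > 0], which contradicts the lower bound
     [b]. *)
  by rewrite le0_lneNy ?lee_fin// gt0_mulNye// lte_fin invr_gt0.
rewrite lne_EFin// -EFinM lte_fin ltr_pdivlMr// => /ltW h.
by rewrite -[leRHS]lnK ?posrE// ler_expR.
Unshelve. all: by end_near. Qed.

(** Two rationals between the rates serve as the exponents [a] and [b] of the transport; the bounds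
    are read at its radii [n] and [3 * n]. *)
Lemma growth_separation f g : (growth_sup g < growth_inf f)%E ->
  exists q q' : rat, q < q' /\ exists m : nat, forall n : nat, (m <= n)%N ->
    expR (ratr q' * ln n%:R) <= f n%:R /\
    g (3 * n%:R) <= expR (ratr q * ln (3 * n%:R)).
Proof.
move=> /lt_ereal_rat[q' [gq' q'f]]; have [q [gq]] := lt_ereal_rat gq'.
rewrite lte_fin ltr_rat => qq'; exists q, q'; split=> //.
have [M [_ HM]] := growth_inf_gt q'f; have [N [_ HN]] := growth_sup_lt gq.
have [m mM] : exists m : nat, `|M| + `|N| < m%:R.
  by exists (Num.trunc (`|M| + `|N|)).+1; rewrite truncnS_gt.
exists m => n; rewrite -(ler_nat R) => mn.
have M0 := ler_norm M; have N0 := ler_norm N.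
have := normr_ge0 M; have := normr_ge0 N => ? ?.
by split; [apply: HM|apply: HN]; lra.
Qed.

Lemma limf_esup_cvg (g : R -> \bar R) (l : \bar R) :
  g r @[r --> +oo] --> l -> (limf_esup g (pinfty_nbhs R) <= l)%E.
Proof.
move=> gl; rewrite leNgt; apply/negP => /lt_ereal_rat[q [lq qg]].
have gq : \forall r \near +oo, (g r < (ratr q : R)%:E)%E.
  exact: (gl _ (open_ereal_lt' lq)).
move: qg; rewrite ltNge => /negP; apply; rewrite limf_esupE.
apply: (@le_trans _ _ (ereal_sup (g @` [set r | (g r < (ratr q : R)%:E)%E]))).
  by apply: ereal_inf_lbound; exists [set r | (g r < (ratr q : R)%:E)%E].
by apply: ge_ereal_sup => _ [r gr <-]; exact: ltW.
Qed.

Lemma growth_sup_le f : has_growth f -> (growth_sup f <= growth f)%E.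
Proof. exact: limf_esup_cvg. Qed.

Lemma growth_inf_ge f : has_growth f -> (growth f <= growth_inf f)%E.
Proof.
move=> fg; rewrite /growth_inf /limf_einf leeNr; apply: limf_esup_cvg.
exact: cvgeN.
Qed.

(** This is [T2 / T1 -> 0], at arbitrarily large radii. *)
Lemma expR_small (a b e : R) : a < b -> 0 < e -> forall m : nat,
  exists2 n : nat, (m <= n)%N & expR (a * ln (3 * n%:R)) <= e * expR (b * ln n%:R).
Proof.
move=> ab e0 m; pose y : R := (a * ln 3 - ln e) / (b - a).
(* The number [y] solves [a * (ln 3 + y) = ln e + b * y]; the inequality holds once [ln n] is at
   least [y]. *)
exists (m + (Num.trunc (expR y)).+1)%N; first exact: leq_addr.
set n := (_ + _)%N; have n0 : 0 < n%:R :> R by rewrite /n ltr0n addnS.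
have yn : y <= ln n%:R.
  rewrite -ler_expR lnK ?posrE//; apply: le_trans (ltW (truncnS_gt _)) _.
  by rewrite ler_nat leq_addl.
rewrite -{1}[e]lnK ?posrE// -expRD ler_expR lnM ?posrE//.
move: yn; rewrite ler_pdivrMr ?subr_gt0//; lra.
Qed.

End growth.

(** * Almost sure comparison of the growth rates *)

Lemma ae_forall_countable d (T : measurableType d) (R : realType)
    (mu : {measure set T -> \bar R}) (I : countType) (Q : I -> T -> Prop) :
  (forall i, \forall x \ae mu, Q i x) -> \forall x \ae mu, forall i, Q i x.
Proof.
move=> HQ.
(* Codes of no index get a trivial statement, which leaves an intersection over the naturals. *)
have : \forall x \ae mu, forall n,
    if unpickle n is Some i then Q i x else True.
  by apply: ae_foralln => n; case: (unpickle n) => [i|]; [exact: HQ|exact: aeW].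
by apply: filterS => x Hx i; have := Hx (pickle i); rewrite pickleK.
Qed.

Section almost_sure.
Context {R : realType} {d : measure_display} {Om : discreteSpace R -> measurableType d}.
Context {P : forall D, probability (Om D) R} {mu : probability (pointed_class R) R}.
Variables (S : set (pointed_class R)) (w1 w2 : weight_process Om).
Hypothesis mu_unimodular : unimodular mu.
Hypothesis S_origin : forall (D : discreteSpace R) (o o' : D),
  S (pclass o) -> S (pclass o').
Hypothesis e1 : equivariant_on P S w1.
Hypothesis e2 : equivariant_on P S w2.
Hypothesis mean_w1 : (mean_weight P mu w1 < +oo)%E.

Section fixed_exponents.
Variables (a b : R) (k : nat).
Hypothesis ab : a < b.

Let T1 (n : nat) : R := expR (b * ln n%:R).
Let T2 (n : nat) : R := expR (a * ln (3 * n%:R)).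

Let T10 n : 0 <= T1 n. Proof. exact: expR_ge0. Qed.
Let T20 n : 0 <= T2 n. Proof. exact: expR_ge0. Qed.

Definition flux (n : nat) (c : pointed_class R) : \bar R :=
  (sender (P := P) S w2 k%:R n%:R (T2 n) c *
   rexpect P S w1 (heavy (T1 n) n%:R) c)%:E.

Lemma flux_ge0 n c : (0 <= flux n c)%E.
Proof.
rewrite lee_fin; apply: mulr_ge0; first exact: sender_ge0.
by apply: rexpect_ge0; exact: heavy_ge0.
Qed.

Lemma measurable_flux n : measurable_fun setT (flux n).
Proof.
apply/measurable_EFinP; apply: measurable_funM; first exact: measurable_sender.
by apply: (measurable_rexpect e1); [exact: observable_heavy|exact: heavy_ge0].
Qed.

(** The integral of the tail infimum is at most that of each [flux n] in the tail, and
    [transport_bound] makes these arbitrarily small along suitable [n]. A nonnegative function with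
    zero integral vanishes almost everywhere. *)
Lemma flux_inf0 : \forall c \ae mu, forall m, einfs (flux ^~ c) m = 0%E.
Proof.
apply: ae_foralln => m.
have inf0 c : (0 <= einfs (flux ^~ c) m)%E.
  by apply: le_ereal_inf_tmp => _ [n _ <-]; exact: flux_ge0.
have minf : measurable_fun setT (fun c => einfs (flux ^~ c) m).
  by apply: measurable_fun_einfs => n; exact: measurable_flux.
have : (\int[mu]_c `|einfs (flux ^~ c) m| = 0)%E.
  under eq_integral do rewrite gee0_abs//.
  apply/eqP; rewrite eq_le integral_ge0// andbT.
  apply/lee_addgt0Pr => e e0; rewrite add0e.
  have mw0 : (0 <= mean_weight P mu w1)%E.
    by apply: integral_ge0 => c _; apply: integral_ge0 => om _; rewrite lee_fin weight_ge0.
  pose K := fine (mean_weight P mu w1).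
  have K0 : 0 <= K by exact: fine_ge0.
  (* Dividing by [K + 1] covers a mean weight [K] equal to 0. *)
  have eK : 0 < e / (K + 1) by rewrite divr_gt0// ltr_wpDl.
  have [n mn Hn] := expR_small ab eK (maxn m k).
  have /andP[mn' kn] : (m <= n)%N && (k <= n)%N by rewrite -geq_max.
  apply: (@le_trans _ _ (\int[mu]_c flux n c)%E).
    apply: le_integral_ge0 => // c; apply: ereal_inf_lbound; by exists n.
  have kn' : (k%:R <= n%:R :> R) by rewrite ler_nat.
  have := @transport_bound _ _ _ _ _ _ _ _ mu_unimodular S_origin e1 e2
    k%:R n%:R (T1 n) (T2 n) (ler0n _ _) kn' (T10 n) (T20 n).
  rewrite -[mean_weight P mu w1]fineK ?ge0_fin_numE// -/K => H.
  have T1n : 0 < T1 n by exact: expR_gt0.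
  rewrite -(@lee_pmul2l _ (T1 n)%:E) ?lte_fin//.
  apply: (le_trans H); rewrite -!EFinM lee_fin.
  apply: (@le_trans _ _ (e / (K + 1) * T1 n * K)); first by rewrite ler_wpM2r.
  rewrite mulrAC [leRHS]mulrC ler_wpM2r// mulrAC ler_pdivrMr ?ltr_wpDl//.
  by rewrite ler_pM2l// lerDl.
move/(ae_eq_integral_abs mu measurableT minf).1.
by apply: filterS => c; apply.
Qed.

(** [E1] and [E2] hold the bounds for all [n >= m] at once, so [P(E1)] times the expectation of [V]
    on [E2], over the ball count, is below every flux of the tail. It is thus 0, and one factor
    vanishes, whatever the dependence between the weights. *)
Lemma negligible_separation (D : discreteSpace R) (o : D) m : S (pclass o) ->
  (k <= m)%N ->
  einfs (flux ^~ (pclass o)) m = 0%E ->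
  \forall om \ae (P D),
    ~ [/\ forall n, (m <= n)%N -> T1 n <= weight_set w1 om (cball o n%:R),
          forall n, (m <= n)%N -> weight_set w2 om (cball o (3 * n%:R)) <= T2 n &
          weight_set w2 om (cball o k%:R) != 0].
Proof.
move=> So km inf0.
pose E1 := \bigcap_(n in [set n | (m <= n)%N]) [set om : Om D |
  T1 n <= weight_set w1 om (cball o n%:R)].
pose E2 := \bigcap_(n in [set n | (m <= n)%N]) [set om : Om D |
  weight_set w2 om (cball o (3 * n%:R)) <= T2 n].
have mW1 r : measurable_fun setT (fun om : Om D => weight_set w1 om (cball o r)).
  exact: (measurable_sampled_on e1 (observable_mass r) So).
have mW2 r : measurable_fun setT (fun om : Om D => weight_set w2 om (cball o r)).
  exact: (measurable_sampled_on e2 (observable_mass r) So).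
have mE1 : measurable E1.
  apply: bigcap_measurableType => n _.
  rewrite -[X in measurable X]setTI.
  exact: (measurable_fun_ler (measurable_cst _) (mW1 _)).
have mE2 : measurable E2.
  apply: bigcap_measurableType => n _.
  rewrite -[X in measurable X]setTI.
  exact: (measurable_fun_ler (mW2 _) (measurable_cst _)).
pose V (om : Om D) := weight_set w2 om (cball o k%:R).
have V0 om : 0 <= V om := mass_ge0 _ (sampled w2 om o).
pose f om := (V om * \1_E2 om)%:E.
have f0 om : (0 <= f om)%E by rewrite lee_fin mulr_ge0.
have mf : measurable_fun setT f.
  apply/measurable_EFinP; apply: measurable_funM; first exact: mW2.
  exact: measurable_indic.
have N0 : 0 < (ncball o (2 * k%:R))^-1 by rewrite invr_gt0 ncball_gt0.
have q0 : (0 <= \int[P D]_om f om)%E by exact: integral_ge0.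
have : (P D E1 * ((\int[P D]_om f om) * ((ncball o (2 * k%:R))^-1)%:E) <= 0)%E.
  rewrite -inf0; apply: le_ereal_inf_tmp => _ [n /= mn <-].
  have kn : k%:R <= n%:R :> R by rewrite ler_nat (leq_trans km).
  have k3n : k%:R <= 3 * n%:R :> R by have := ler0n R n; lra.
  rewrite /flux [in leRHS]mulrC EFinM /sender ncballc_pclass EFinM.
  rewrite (rexpectE e1 (observable_heavy _ _) (@heavy_ge0 R _ _) (@heavy_le1 R _ _) So).
  rewrite (rexpectE e2 (observable_light _ _ _) (@light_ge0 R _ _ _)
    (fun X => light_le X k3n (T20 n)) So).
  apply: lee_pmul => //; first by rewrite mule_ge0// lee_fin ltW.
    rewrite -[E1]setIT -integral_indic//.
    apply: le_integral_ge0 => om; rewrite lee_fin ?indic_ge0//.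
    rewrite indicE; case: (boolP (om \in E1)) => [/set_mem /(_ n mn) /= omE|_].
      by rewrite /heavy massE omE.
    exact: heavy_ge0.
  rewrite lee_pmul2r//.
  apply: le_integral_ge0 => // om; rewrite lee_fin indicE.
  case: (boolP (om \in E2)) => [/set_mem /(_ n mn) /= omE|_].
    by rewrite /light !massE omE.
  by rewrite mulr0; exact: light_ge0.
move=> PE1q; have /eqP : (P D E1 * ((\int[P D]_om f om) *
    ((ncball o (2 * k%:R))^-1)%:E) = 0)%E.
  by apply/eqP; rewrite eq_le PE1q/= !mule_ge0// lee_fin ltW.
(* Either [E1] is null, or [V] vanishes almost surely on [E2]; the ball count is positive. *)
rewrite !mule_eq0 => /or3P[/eqP PE1|/eqP q_eq0|]; last first.
- by rewrite eqe gt_eqF.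
- have : (\int[P D]_om `|f om| = 0)%E.
    by under eq_integral do rewrite gee0_abs//.
  move/(ae_eq_integral_abs (P D) measurableT mf).1.
  apply: filterS => om /(_ I) [] /eqP fom [_ om2 Vom].
  move: fom; rewrite mulf_eq0 (negbTE Vom)/= indicE mem_set//.
  by rewrite oner_eq0.
- exists E1; split => // om /=; apply: contra_notP => omE1.
  by move=> [om1 _ _]; apply: omE1 => n; exact: om1.
Qed.

End fixed_exponents.

(** A failure would produce rational exponents and natural [k], [m] for which the separation occurs.
    These are countably many null events: first over classes, then over the extra randomness of a
    fixed space. *)
Lemma growth_inf_le_sup : (\forall c \ae mu, S c) ->
  almost_surely P mu (fun D _ => [set om | exists v : D, weight w2 om v != 0]) ->
  almost_surely P mu (fun D o => [set om |
    (growth_inf (fun r => weight_set w1 om (cball o r)) <=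
     growth_sup (fun r => weight_set w2 om (cball o r)))%E]).
Proof.
move=> aeS w2_neq0.
pose inf0 (q q' : rat) (k : nat) c :=
  q < q' -> forall m, einfs ((flux (ratr q) (ratr q') k) ^~ c) m = 0%E.
have ae_inf : \forall c \ae mu, forall q q' k, inf0 q q' k c.
  suff : \forall c \ae mu, forall x : rat * rat * nat, inf0 x.1.1 x.1.2 x.2 c.
    by apply: filterS => c Hc q q' k; exact: (Hc (q, q', k)).
  apply: ae_forall_countable => -[[q q'] k] /=.
  rewrite /inf0; have [qq'|_] := ltP q q'; last exact: aeW.
  have := @flux_inf0 (ratr q) (ratr q') k; rewrite ltr_rat => /(_ qq').
  by apply: filterS => c cq _.
move: aeS ae_inf w2_neq0; apply: filterS3 => c Sc infc w2c D o oc.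
have So : S (pclass o) by rewrite oc.
pose sep (q q' : rat) (k m : nat) om := q < q' -> (k <= m)%N ->
  ~ [/\ forall n, (m <= n)%N ->
          expR (ratr q' * ln n%:R) <= weight_set w1 om (cball o n%:R),
        forall n, (m <= n)%N ->
          weight_set w2 om (cball o (3 * n%:R)) <= expR (ratr q * ln (3 * n%:R)) &
        weight_set w2 om (cball o k%:R) != 0].
have ae_sep : \forall om \ae (P D), forall q q' k m, sep q q' k m om.
  suff : \forall om \ae (P D), forall x : rat * rat * nat * nat,
      sep x.1.1.1 x.1.1.2 x.1.2 x.2 om.
    by apply: filterS => om Hom q q' k m; exact: (Hom (q, q', k, m)).
  apply: ae_forall_countable => -[[[q q'] k] m] /=.
  rewrite /sep; have [qq'|_] := ltP q q'; last exact: aeW.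
  have [km|_] := leqP k m; last exact: aeW.
  have := @negligible_separation (ratr q) (ratr q') k D o m So km.
  rewrite oc => /(_ (infc _ _ _ qq' _)).
  by apply: filterS => om omq _ _.
move: (w2c D o oc) ae_sep; apply: filterS2 => om [v vom] sep_om /=.
rewrite leNgt; apply/negP => /growth_separation[q [q' [qq' [m Hm]]]].
(* The ball of this radius contains the point [v] of nonzero weight, so its [w2] mass is
   positive. *)
pose k := (Num.trunc (mdist o v)).+1.
apply: (sep_om q q' k (maxn m k) qq' (leq_maxr _ _)); split.
- by move=> n; rewrite geq_max => /andP[/Hm[]].
- by move=> n; rewrite geq_max => /andP[/Hm[]].
- rewrite gt_eqF//; apply: (@lt_le_trans _ _ (weight w2 om v)).
    by rewrite lt_neqAle eq_sym vom weight_ge0.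
  apply: (@le_trans _ _ (\sum_(x \in [set v]) weight w2 om x)).
    by rewrite fsbig_set1.
  apply: ler_fsum_subset.
  + exact: finite_cball.
  + by move=> _ ->; rewrite /cball/= ltW// truncnS_gt.
  + by move=> x _; exact: weight_ge0.
Qed.

End almost_sure.

(** * A common domain for both weight functions, and the conclusion *)

Lemma equivariant_processes_common (R : realType) (d : measure_display)
    (mu : probability (pointed_class R) R)
    (Om : discreteSpace R -> measurableType d)
    (P : forall D : discreteSpace R, probability (Om D) R)
    (w1 w2 : weight_process Om) :
  equivariant_process P mu w1 -> equivariant_process P mu w2 ->
  exists S : set (pointed_class R),
  [/\ \forall c \ae mu, S c,
      forall (D : discreteSpace R) (o o' : D), S (pclass o) -> S (pclass o'),
      equivariant_on P S w1 & equivariant_on P S w2].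
Proof.
have ae1 (A : set (pointed_class R)) :
    measurable A -> mu A = 1%E -> \forall c \ae mu, A c.
  move=> mA muA; exists (~` A); split => //; first exact: measurableC.
  by rewrite probability_setC// muA subee.
move=> [S1 [[mS1 muS1] o1 p1 q1 r1]] [S2 [[mS2 muS2] o2 p2 q2 r2]].
have mS : measurable (S1 `&` S2) by exact: measurableI.
exists (S1 `&` S2); split.
- by move: (ae1 _ mS1 muS1) (ae1 _ mS2 muS2); apply: filterS2.
- by move=> D o o' [S1o S2o]; split; [exact: o1 S1o|exact: o2 S2o].
- by apply: (@equivariant_onS _ _ _ _ _ S1).
- by apply: (@equivariant_onS _ _ _ _ _ S2).
Qed.

Theorem theorem5p19 (R : realType) (d : measure_display)
    (mu : probability (pointed_class R) R)
    (Om : discreteSpace R -> measurableType d)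
    (P : forall D : discreteSpace R, probability (Om D) R)
    (w1 w2 : weight_process Om) :
  unimodular mu ->
  equivariant_process P mu w1 -> equivariant_process P mu w2 ->
  almost_surely P mu (fun D _ => [set om | exists v : D, weight w2 om v != 0]) ->
  (mean_weight P mu w1 < +oo)%E ->
  almost_surely P mu (fun D o => [set om |
    (growth_inf (fun r => weight_set w1 om (cball o r)) <=
     growth_sup (fun r => weight_set w2 om (cball o r)))%E]) /\
  (almost_surely P mu (fun D _ => [set om | exists v : D, weight w1 om v != 0]) ->
   (mean_weight P mu w2 < +oo)%E ->
   almost_surely P mu (fun D o => [set om |
     has_growth (fun r => weight_set w1 om (cball o r)) ->
     has_growth (fun r => weight_set w2 om (cball o r)) ->
     growth (fun r => weight_set w1 om (cball o r)) =
     growth (fun r => weight_set w2 om (cball o r))])).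
Proof.
move=> um eq1 eq2 w2_neq0 mean1.
have [S [aeS oS e1 e2]] := equivariant_processes_common eq1 eq2.
have le12 := growth_inf_le_sup um oS e1 e2 mean1 aeS w2_neq0.
split=> // w1_neq0 mean2.
(* The comparison with the roles of [w1] and [w2] exchanged; two opposite inequalities then give
   equality of the limits. *)
have le21 := growth_inf_le_sup um oS e2 e1 mean2 aeS w1_neq0.
move: le12 le21; apply: filterS2 => c le12 le21 D o oc.
move: (le12 D o oc) (le21 D o oc); apply: filterS2 => om /= l12 l21 g1 g2.
apply/eqP; rewrite eq_le; apply/andP; split.
- by apply: le_trans (growth_inf_ge g1) (le_trans l12 (growth_sup_le g2)).
- by apply: le_trans (growth_inf_ge g2) (le_trans l21 (growth_sup_le g1)).
Qed.
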